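(* Let $(G_n)_{n\ge 1}$ be a sequence of (possibly random) finite graphs that converges locally to a random rooted locally finite connected graph $(U,\rho)$, and suppose that $(U,\rho)$ has nonexplosive growth. Then $\bar\iota(G_n)\to\iota(U,\rho)$ as $n\to\infty$.
   Context: Random labelling: for a (possibly infinite, possibly random) graph $G=(V,E)$, a random labelling is a family $\sigma=(\sigma_v)_{v\in V}$ of i.i.d. random variables uniform on $[0,1]$ (independent of $G$ if $G$ is random). For a finite graph $G$, $\mathbf I_\sigma(G)$ is the random greedy maximal independent set: vertices are considered one by one in increasing order of label, and the current vertex is added to the set if and only if it is not adjacent to any previously added vertex. Let $\iota(G)=|\mathbf I_\sigma(G)|/|V(G)|$ and $\bar\iota(G)=\mathbb E[\iota(G)]$, the expectation being over both $\sigma$ and (if random) $G$. Past and nonexplosive growth: the past $\mathcal P_v$ of a vertex $v$ is the set of vertices reachable from $v$ by a path along which the labels $\sigma$ are monotone decreasing (including $v$ itself). A random rooted locally finite graph $(U,\rho)$ has nonexplosive growth if, for a random labelling $\sigma$ of $U$, the past $\mathcal P_\rho$ of $\rho$ is almost surely finite. In that case $\iota(U,\rho)=\mathbb P[\rho\in\mathbf I_\sigma(U[\mathcal P_\rho])]$, where $U[\mathcal P_\rho]$ is the induced subgraph. Local convergence: for a rooted graph $(G,\rho)$ let $B_G(\rho,r)$ be the rooted subgraph spanned by the vertices at distance at most $r$ from $\rho$, viewed up to root-preserving isomorphism. $G_n$ converges locally to $(U,\rho)$ if for every integer $r\ge 0$, $B_{G_n}(\rho_n,r)$ converges in distribution to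 $B_U(\rho,r)$, where $\rho_n$ is a uniformly chosen vertex of $G_n$ and the space of rooted balls of radius $r$ (isomorphism classes) carries the discrete topology. *)

(* Defs.v *)
From HB Require Import structures.
From mathcomp Require Import all_boot all_order all_algebra finmap.
From mathcomp Require Import all_classical all_reals all_analysis.

Set Implicit Arguments.
Unset Strict Implicit.
Unset Printing Implicit Defensive.

Import Order.TTheory GRing.Theory Num.Theory.
Import numFieldNormedType.Exports.

Local Open Scope classical_set_scope.
Local Open Scope ring_scope.

(* A simple graph whose vertex set is an arbitrary part of the type V. Random
   graphs have V countable: a locally finite connected graph is countable, and
   every notion below is invariant under isomorphism. *)
Record graph (V : Type) := Graph {
  vert : pred V;
  adj : rel V;
  adj_sym : symmetric adj;
  adj_irrefl : irreflexive adj;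
  adj_vert : forall u v, adj u v -> vert u && vert v }.

Definition verts (V : Type) (g : graph V) : set V := [set v | vert g v].

Section Induced.
Variables (V : Type) (g : graph V) (A : set V).

Let ivert : pred V := fun u => vert g u && (u \in A).
Let iadj : rel V := fun u v => [&& adj g u v, u \in A & v \in A].

Fact induced_sym : symmetric iadj.
Proof. by move=> u v; rewrite /iadj adj_sym [X in _ && X]andbC. Qed.

Fact induced_irrefl : irreflexive iadj.
Proof. by move=> u; rewrite /iadj adj_irrefl. Qed.

Fact induced_vert u v : iadj u v -> ivert u && ivert v.
Proof.
rewrite /iadj /ivert => /and3P[guv -> ->].
by rewrite !andbT; exact: adj_vert guv.
Qed.

Definition induced : graph V := Graph induced_sym induced_irrefl induced_vert.
End Induced.

Definition finite_graph (V : Type) (g : graph V) := finite_set (verts g).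

Definition locally_finite (V : Type) (g : graph V) :=
  forall v, verts g v -> finite_set [set u | adj g v u].

Definition connected_graph (V : Type) (g : graph V) :=
  forall u v, verts g u -> verts g v ->
    exists p : seq V, path (adj g) u p /\ last u p = v.

Definition ball_verts (V : Type) (g : graph V) (v : V) (r : nat) : set V :=
  [set u | exists p : seq V,
     [/\ (size p <= r)%N, path (adj g) v p & last v p = u]].

Definition rooted_ball (V : Type) (g : graph V) (v : V) (r : nat) : graph V :=
  induced g (ball_verts g v r).

Definition rooted_iso (V W : Type) (g : graph V) (u : V) (h : graph W) (v : W) :=
  exists f : V -> W,
    [/\ set_bij (verts g) (verts h) f,
        f u = v &
        forall x y, verts g x -> verts g y -> adj h (f x) (f y) = adj g x y].

(* The isomorphism class of a countable rooted graph, encoded as the set of all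
   its isomorphic copies on subsets of nat, so that classes of graphs with
   different vertex types can be compared. *)
Definition rooted_class := set (graph nat * nat).

Definition class_of (V : Type) (g : graph V) (v : V) : rooted_class :=
  [set h | rooted_iso g v h.1 h.2].

Definition greedy_mis (R : realType) (V : choiceType) (g : graph V)
    (s : V -> R) : {fset V} :=
  foldl (fun (I : {fset V}) v =>
           if has (adj g v) (enum_fset I) then I else (v |` I)%fset)
        fset0
        (sort (fun u v => s u <= s v) (enum_fset (fset_set (verts g)))).

Definition iota_graph (R : realType) (V : choiceType) (g : graph V)
    (s : V -> R) : R :=
  #|` greedy_mis g s|%:R / #|` fset_set (verts g)|%:R.

Definition past (R : realType) (V : Type) (g : graph V) (s : V -> R) (v : V) :
    set V :=
  [set u | exists p : seq V,
     path (fun x y => adj g x y && (s y < s x)) v p /\ last v p = u].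

Definition graph_events (T : Type) (V : Type) (G : T -> graph V) :
    set (set T) :=
  [set A | (exists v, A = [set w | vert (G w) v]) \/
           (exists u v, A = [set w | adj (G w) u v])].

Definition root_events (T : Type) (V : Type) (rho : T -> V) : set (set T) :=
  [set A | exists v, A = [set w | rho w = v]].

Record random_graph d (T : measurableType d) (V : countType) := RandomGraph {
  rgraph :> T -> graph V;
  measurable_rgraph : graph_events rgraph `<=` measurable }.

Record random_root d (T : measurableType d) (V : countType)
    (G : random_graph T V) := RandomRoot {
  rroot :> T -> V;
  rroot_vert : forall w, verts (G w) (rroot w);
  measurable_rroot : root_events rroot `<=` measurable }.

(* Conditionally on G, which takes countably many values, the root is uniform
   on the vertex set of G. *)
Definition uniform_root d (T : measurableType d) (R : realType)
    (P : probability T R) (V : countType) (G : random_graph T V)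
    (rho : random_root G) :=
  forall (g : graph V) (v : V), finite_graph g -> verts g v ->
    P [set w | G w = g /\ rho w = v] =
    ((#|` fset_set (verts g)|%:R^-1)%:E * P [set w | G w = g])%E.

Definition mutually_independent d (T : measurableType d) (R : realType)
    (P : probability T R) (I : choiceType) (F : I -> set (set T)) :=
  forall (J : {fset I}) (E : I -> set T), (forall i, i \in J -> F i (E i)) ->
    P (\bigcap_(i in [set` J]) E i) = (\prod_(i <- enum_fset J) P (E i))%E.

Definition independent2 d (T : measurableType d) (R : realType)
    (P : probability T R) (F H : set (set T)) :=
  forall A B, F A -> H B -> P (A `&` B) = (P A * P B)%E.

(* The labels are attached to all elements of the vertex type, whether or not
   they are vertices of the random graph; F is the sigma-algebra generated by
   the random graph. *)
Definition random_labelling d (T : measurableType d) (R : realType)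
    (P : probability T R) (V : countType) (sigma : V -> {RV P >-> R})
    (F : set (set T)) :=
  [/\ forall v (B : set R), measurable B ->
        distribution P (sigma v) B = uniform_prob (@ltr01 R) B,
      mutually_independent P
        (fun v => preimage_set_system setT (sigma v) measurable) &
      independent2 P
        <<s \bigcup_v preimage_set_system setT (sigma v) measurable >> F].

Definition cvg_in_law (R : realType) (S : topologicalType)
    (dn : nat -> measure_display) (Tn : forall n, measurableType (dn n))
    (Pn : forall n, probability (Tn n) R) (Xn : forall n, Tn n -> S)
    d (T : measurableType d) (P : probability T R) (X : T -> S) :=
  forall f : S -> R, continuous f -> bounded_fun f ->
    ('E_(Pn n)[f \o Xn n] @[n --> \oo] --> 'E_P[f \o X])%E.

Definition local_cvg (R : realType)
    (dn : nat -> measure_display) (Tn : forall n, measurableType (dn n))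
    (Pn : forall n, probability (Tn n) R) (Vn : nat -> countType)
    (Gn : forall n, random_graph (Tn n) (Vn n))
    (rhon : forall n, random_root (Gn n))
    d (T : measurableType d) (P : probability T R) (V : countType)
    (U : random_graph T V) (rho : random_root U) :=
  forall r : nat,
    @cvg_in_law R (discrete_topology rooted_class) dn Tn Pn
      (fun n w => class_of (rooted_ball (Gn n w) (rhon n w) r) (rhon n w))
      d T P
      (fun w => class_of (rooted_ball (U w) (rho w) r) (rho w)).

Definition nonexplosive d (T : measurableType d) (R : realType)
    (P : probability T R) (V : countType) (U : random_graph T V)
    (rho : random_root U) (sigma : V -> {RV P >-> R}) :=
  {ae P, forall w, finite_set (past (U w) (fun v => sigma v w) (rho w))}.

Definition iota_bar d (T : measurableType d) (R : realType)
    (P : probability T R) (V : countType) (G : random_graph T V)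
    (sigma : V -> {RV P >-> R}) : \bar R :=
  ('E_P[fun w => iota_graph (G w) (fun v => sigma v w)])%E.

(* When the past is infinite, greedy_mis returns the junk value fset0; under
   nonexplosive growth this is a null event. *)
Definition iota_rooted d (T : measurableType d) (R : realType)
    (P : probability T R) (V : countType) (U : random_graph T V)
    (rho : random_root U) (sigma : V -> {RV P >-> R}) : \bar R :=
  P [set w | let s := fun v => sigma v w in
             rho w \in greedy_mis (induced (U w) (past (U w) s (rho w))) s].

(* Main.v *)
(* A vertex is in the greedy set iff no neighbour of smaller label is. If no path
   of r edges with decreasing labels starts at v, then r levels of this recursion
   decide whether v is in the greedy set, and they only read the labels of the
   r-ball around v. Hence the probability that the root is in the greedy set
   differs by at most E[psi_r] from E[phi_r], where phi_r and psi_r are functions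
   of the isomorphism class of the r-ball: the probabilities, under independent
   uniform labels, that the truncated recursion accepts the root and that a
   decreasing path of r edges starts there. Local convergence applies to both
   expectations, and on the limit E[psi_r] tends to 0 as r grows, because a finite
   past contains no arbitrarily long decreasing path. On the finite side,
   conditioning on the graph turns the expected density of the greedy set into
   the probability that a uniform root belongs to it. *)
Require Import Defs.
From mathcomp Require Import all_boot all_order all_algebra finmap.
From mathcomp Require Import all_classical all_reals all_analysis.
From mathcomp Require Import measurable_realfun lra.

Import Order.TTheory GRing.Theory Num.Theory.
Import numFieldNormedType.Exports.

Local Open Scope classical_set_scope.
Local Open Scope ring_scope.

Set Implicit Arguments.
Unset Strict Implicit.
Unset Printing Implicit Defensive.

(** * The greedy set and the truncated recursion *)

(** The greedy rule unfolded for [k] levels. At level zero every vertex is accepted, a default that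
    is never reached when no [D]-path of [k] edges starts at [v]. *)
Fixpoint win (V : Type) (D : rel V) (k : nat) (v : V) : Prop :=
  if k is k'.+1 then forall u, D v u -> ~ win D k' u else True.

Fixpoint long (V : Type) (D : rel V) (k : nat) (v : V) : Prop :=
  if k is k'.+1 then exists2 u, D v u & long D k' u else True.

Definition down (R : realType) (V : Type) (g : graph V) (s : V -> R) : rel V :=
  fun v u => adj g v u && (s u < s v).

Section Bisimulation.
Variables (V W : Type) (D : rel V) (D' : rel W) (E : nat -> V -> W -> Prop).
Hypothesis forth : forall k x y, E k.+1 x y ->
  forall u, D x u -> exists2 z, D' y z & E k u z.
Hypothesis back : forall k x y, E k.+1 x y ->
  forall z, D' y z -> exists2 u, D x u & E k u z.

(** The index of [E] is the number of levels left, so that a match valid only near the root may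
    weaken at each step. The negation in [win] swaps the two implications, so the induction carries
    the equivalence. Balls, pasts and isomorphic copies are the three uses. *)
Lemma win_bisim k x y : E k x y -> win D k x <-> win D' k y.
Proof.
elim: k x y => [//|k IH] x y Exy /=; split => wx.
- move=> z Dz wz; have [u Du Euz] := back Exy Dz.
  by apply: (wx u Du); apply/(IH _ _ Euz).
- move=> u Du wu; have [z Dz Euz] := forth Exy Du.
  by apply: (wx z Dz); apply/(IH _ _ Euz).
Qed.

Lemma long_bisim k x y : E k x y -> long D k x <-> long D' k y.
Proof.
elim: k x y => [//|k IH] x y Exy /=; split => -[].
- move=> u Du lu; have [z Dz Euz] := forth Exy Du.
  by exists z => //; apply/(IH _ _ Euz).
- move=> z Dz lz; have [u Du Euz] := back Exy Dz.
  by exists u => //; apply/(IH _ _ Euz).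
Qed.

End Bisimulation.

Lemma longS (V : Type) (D : rel V) k v : long D k.+1 v -> long D k v.
Proof. by elim: k v => [//|k IH] v [u Du lu]; exists u => //; exact: IH. Qed.

Lemma long_le (V : Type) (D : rel V) j k v :
  (j <= k)%N -> long D k v -> long D j v.
Proof.
move=> jk; rewrite -{1}(subnK jk); elim: (k - j)%N => [//|m IH].
by move=> lv; apply: IH; apply: longS.
Qed.

Lemma long_path (V : Type) (D : rel V) k v :
  long D k v -> exists2 p, path D v p & size p = k.
Proof.
elim: k v => [|k IH] v; first by exists [::].
by case=> u Du /IH[p pp <-]; exists (u :: p); rewrite //= Du.
Qed.

Section Greedy.
Variables (R : realType) (V : choiceType) (g : graph V) (s : V -> R).

Let step (I : {fset V}) v :=
  if has (adj g v) (enum_fset I) then I else (v |` I)%fset.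

Lemma foldl_greedyP (l : seq V) (I : {fset V}) x :
  (x \in foldl step I l) -> (x \in I) || (x \in l).
Proof.
elim: l I => [|y l IH] I /=; first by move=> ->.
move=> /IH; rewrite in_cons /step; case: ifP => _.
  by case/orP => ->; rewrite ?orbT.
by rewrite !inE => /orP[/orP[->|->]|->]; rewrite ?orbT.
Qed.

Lemma foldl_greedy_sub (l : seq V) (I : {fset V}) x :
  x \in I -> x \in foldl step I l.
Proof.
elim: l I => [//|y l IH] I xI /=; apply: IH; rewrite /step; case: ifP => // _.
by rewrite !inE xI orbT.
Qed.

(** Sorting puts exactly the vertices of smaller label before [v], in [l1]; injectivity excludes
    ties. The decision on [v] is made against the set [I] built from [l1], and the later steps
    neither remove a vertex nor add one of [l1]. *)
Lemma greedy_misE v : finite_graph g -> {in verts g &, injective s} ->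
  verts g v ->
  v \in greedy_mis g s <-> forall u, down g s v u -> u \notin greedy_mis g s.
Proof.
move=> fg sinj gv; rewrite /greedy_mis -/step.
set l := sort _ _.
have ml x : (x \in l) = (x \in verts g) by rewrite mem_sort in_fset_set.
have ul : uniq l by rewrite sort_uniq fset_uniq.
have sl : sorted (fun x y => s x <= s y) l.
  by apply: sort_sorted => x y; exact: le_total.
have vl : v \in l by rewrite ml inE.
move: ml ul sl; case/splitPr : vl => l1 l2 ml ul sl.
have tr : transitive (fun x y => s x <= s y) by move=> y x z; exact: le_trans.
have uv u : u \in l1 -> s u < s v.
  move=> ul1; rewrite lt_neqAle; apply/andP; split.
    apply/eqP => /sinj suv; move: ul; rewrite cat_uniq => /and3P[_ /hasPn /=].
    move=> /(_ v); rewrite in_cons eqxx => /(_ isT) /negP h _; apply: h.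
    by rewrite -suv // -ml ?mem_cat ?in_cons ?eqxx ?ul1 ?orbT.
  move: sl; rewrite (sorted_pairwise tr) pairwise_cat => /andP[/allrelP + _].
  by apply => //; rewrite in_cons eqxx.
have uv2 u : u \in l2 -> ~~ (s u < s v).
  move=> ul2; rewrite -leNgt.
  move: sl; rewrite (sorted_pairwise tr) pairwise_cat => /and3P[_ _] /=.
  by move=> /andP[/allP + _]; apply.
rewrite foldl_cat /=; set I := foldl step fset0 l1.
have Il1 u : u \in I -> u \in l1 by move=> /foldl_greedyP; rewrite inE.
have vl1 : v \notin l1.
  move: ul; rewrite cat_uniq => /and3P[_ /hasPn/(_ v) + _].
  by rewrite in_cons eqxx; apply.
have vl2 : v \notin l2.
  by move: ul; rewrite cat_uniq => /and3P[_ _ /=/andP[]].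
have inI u : u \in l1 -> u \in foldl step (step I v) l2 -> u \in I.
  move=> ul1 /foldl_greedyP /orP[|ul2]; last first.
    move: ul; rewrite cat_uniq => /and3P[_ /hasPn/(_ u)].
    by rewrite in_cons ul2 orbT => /(_ isT); rewrite ul1.
  rewrite /step; case: ifP => // _; rewrite !inE => /orP[/eqP uv1|//].
  by rewrite -uv1 ul1 in vl1.
split.
- move=> vin u /andP[vu su]; apply/negP => uin.
  have ul1 : u \in l1.
    have : u \in l1 ++ v :: l2.
      by rewrite ml inE; case/andP: (adj_vert vu).
    rewrite mem_cat in_cons => /or3P[//|/eqP uv1|/uv2/negP//].
    by rewrite uv1 ltxx in su.
  have uI := inI _ ul1 uin.
  have hv : has (adj g v) (enum_fset I) by apply/hasP; exists u.
  move: vin => /foldl_greedyP; rewrite /step hv (negPf vl2) orbF => /Il1.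
  by rewrite (negPf vl1).
- move=> H; apply: foldl_greedy_sub; rewrite /step; case: ifP => [/hasP[u uI vu]|_].
    have := H u; rewrite /down vu uv ?Il1 // => /(_ isT).
    by rewrite foldl_greedy_sub // /step; case: ifP => // _; rewrite !inE uI orbT.
  by rewrite !inE eqxx.
Qed.

Lemma greedy_mis_vert v : finite_graph g -> v \in greedy_mis g s -> verts g v.
Proof.
by move=> fg /foldl_greedyP; rewrite inE /= mem_sort in_fset_set // inE.
Qed.

(** Induction on [k]: a path of [k] edges from a lower neighbour of [v] would extend to one of
    [k.+1] edges from [v]. The base case is void, since a path without edges always exists. *)
Lemma greedy_mis_win k v : finite_graph g -> {in verts g &, injective s} ->
  verts g v -> ~ long (down g s) k v ->
  v \in greedy_mis g s <-> win (down g s) k v.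
Proof.
move=> fg sinj; elim: k v => [|k IH] v gv nl; first by case: nl.
rewrite greedy_misE //; split => H u vu.
- have /andP[_ gu] := adj_vert (andP vu).1.
  move=> wu; move/negP: (H u vu); apply; apply/IH => //.
  by move=> lu; apply: nl; exists u.
- have /andP[_ gu] := adj_vert (andP vu).1.
  apply/negP => /IH wu; apply: (H u vu); apply: wu => //.
  by move=> lu; apply: nl; exists u.
Qed.

End Greedy.

(** Passing to the subtype of the members of [l] turns agreement on [l] into equality of relations.
    In [measurable_greedy] two relations agree only on a finite list of vertices. *)
Lemma eq_in_sort (T : eqType) (l : seq T) (le1 le2 : rel T) :
  {in l &, le1 =2 le2} -> sort le1 l = sort le2 l.
Proof.
move=> le12; have /all_sigP[l' ll'] : all (mem l) l by apply/allP.
rewrite ll' !sort_map; congr (map _ (sort _ _)).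
by apply/funext => x; apply/funext => y; apply: le12; exact: valP.
Qed.

Section Locality.
Variables (R : realType) (V : Type) (g : graph V) (s : V -> R).

Lemma ball_verts_root v r : ball_verts g v r v.
Proof. by exists [::]. Qed.

Lemma ball_verts_adj v r x u : ball_verts g v r x -> adj g x u ->
  ball_verts g v r.+1 u.
Proof.
case=> p [sp pp <-] xu; exists (rcons p u).
by rewrite size_rcons rcons_path last_rcons pp xu.
Qed.

Lemma ball_verts_le v r r' x : (r <= r')%N ->
  ball_verts g v r x -> ball_verts g v r' x.
Proof. by move=> rr' [p [sp pp <-]]; exists p; rewrite (leq_trans sp). Qed.

(** With [k] levels left, the recursion stands within distance [r - k] of the root, so every
    neighbour it still has to read lies in the [r]-ball. *)
Let ballE v r k x y :=
  [/\ x = y, (k <= r)%N & ball_verts g v (r - k) x].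

Let ball_step v r k x u : (k.+1 <= r)%N -> ball_verts g v (r - k.+1) x ->
  adj g x u -> ball_verts g v (r - k) u.
Proof.
by move=> kr /ball_verts_adj/[apply]; rewrite -subSn // subSS.
Qed.

Let ball_forth v r k x y : ballE v r k.+1 x y ->
  forall u, down (rooted_ball g v r) s x u ->
    exists2 z, down g s y z & ballE v r k u z.
Proof.
move=> [<- kr bx] u /andP[/and3P[xu _ _] su]; exists u; first by rewrite /down xu.
by split; [|exact: ltnW|exact: ball_step xu].
Qed.

Let ball_back v r k x y : ballE v r k.+1 x y ->
  forall z, down g s y z ->
    exists2 u, down (rooted_ball g v r) s x u & ballE v r k u z.
Proof.
move=> [<- kr bx] u /andP[xu su]; have bu := ball_step kr bx xu.
exists u; last by split => //; exact: ltnW.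
rewrite /down su andbT /= xu /=.
by apply/andP; split; rewrite inE;
  [apply: ball_verts_le bx|apply: ball_verts_le bu]; rewrite leq_subr.
Qed.

Lemma win_ball v r :
  win (down (rooted_ball g v r) s) r v <-> win (down g s) r v.
Proof.
apply: (win_bisim (@ball_forth v r) (@ball_back v r)).
by split => //; exact: ball_verts_root.
Qed.

Lemma long_ball v r :
  long (down (rooted_ball g v r) s) r v <-> long (down g s) r v.
Proof.
apply: (long_bisim (@ball_forth v r) (@ball_back v r)).
by split => //; exact: ball_verts_root.
Qed.

Lemma past_root v : past g s v v. Proof. by exists [::]. Qed.

Lemma past_down v x u : past g s v x -> down g s x u -> past g s v u.
Proof.
case=> p [pp <-] xu; exists (rcons p u).
by rewrite rcons_path last_rcons pp.
Qed.

(** The past is closed under decreasing steps, so this match does not weaken with depth. *)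
Let pastE v (k : nat) x y := x = y /\ past g s v x.

Let past_forth v k x y : pastE v k.+1 x y ->
  forall u, down (Defs.induced g (past g s v)) s x u ->
    exists2 z, down g s y z & pastE v k u z.
Proof.
move=> [<- px] u /andP[/and3P[xu _ _] su].
have xu' : down g s x u by rewrite /down xu.
by exists u => //; split => //; exact: past_down xu'.
Qed.

Let past_back v k x y : pastE v k.+1 x y ->
  forall z, down g s y z ->
    exists2 u, down (Defs.induced g (past g s v)) s x u & pastE v k u z.
Proof.
move=> [<- px] u xu; have pu := past_down px xu; exists u => //.
case/andP: xu => xu su; rewrite /down su andbT /= xu /=.
by apply/andP; split; rewrite inE.
Qed.

Lemma win_past v k :
  win (down (Defs.induced g (past g s v)) s) k v <-> win (down g s) k v.
Proof.
by apply: (win_bisim (@past_forth v) (@past_back v)); split => //; exact: past_root.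
Qed.

Lemma long_past v k :
  long (down (Defs.induced g (past g s v)) s) k v <-> long (down g s) k v.
Proof.
by apply: (long_bisim (@past_forth v) (@past_back v)); split => //; exact: past_root.
Qed.

End Locality.

Section Isomorphism.
Variables (R : realType) (V W : Type) (g : graph V) (h : graph W) (f : V -> W).
Variable t : W -> R.
Hypothesis fbij : set_bij (verts g) (verts h) f.
Hypothesis fadj : forall x y, verts g x -> verts g y ->
  adj h (f x) (f y) = adj g x y.

Let isoE (k : nat) x y := y = f x /\ verts g x.

Let iso_forth k x y : isoE k.+1 x y -> forall u, down g (t \o f) x u ->
  exists2 z, down h t y z & isoE k u z.
Proof.
move=> [-> gx] u /andP[xu su]; have /andP[_ gu] := adj_vert xu.
by exists (f u) => //; rewrite /down fadj // xu.
Qed.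

Let iso_back k x y : isoE k.+1 x y -> forall z, down h t y z ->
  exists2 u, down g (t \o f) x u & isoE k u z.
Proof.
move=> [-> gx] z /andP[xz sz]; have /andP[_ hz] := adj_vert xz.
have [u gu fu] := set_bij_surj fbij hz.
by exists u => //; rewrite -fu in xz sz *; rewrite /down -fadj // xz.
Qed.

Lemma win_iso k x : verts g x ->
  win (down g (t \o f)) k x <-> win (down h t) k (f x).
Proof. by move=> gx; apply: (win_bisim iso_forth iso_back). Qed.

Lemma long_iso k x : verts g x ->
  long (down g (t \o f)) k x <-> long (down h t) k (f x).
Proof. by move=> gx; apply: (long_bisim iso_forth iso_back). Qed.

End Isomorphism.

Lemma rooted_iso_sym (V W : Type) (g : graph V) (v : V) (h : graph W) (w : W) :
  verts g v -> rooted_iso g v h w -> rooted_iso h w g v.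
Proof.
move=> gv [f [fbij fv fadj]].
pose f' := 'pinv_(fun=> v) (verts g) f.
have f'bij : set_bij (verts h) (verts g) f' := bijpinv_bij _ fbij.
have f'K y : verts h y -> f (f' y) = y.
  by move=> hy; apply: (surjpK _ (set_bij_surj fbij)); rewrite ?inE.
exists f'; split => //.
- have hw : verts h w by rewrite -fv; apply: (set_bij_homo fbij).
  apply: (set_bij_inj fbij); rewrite ?inE ?f'K //.
  exact: (set_bij_homo f'bij).
- move=> x y hx hy; rewrite -fadj ?f'K //.
  - exact: (set_bij_homo f'bij).
  - exact: (set_bij_homo f'bij).
Qed.

(** Labels strictly decrease along the path, so its vertices are distinct, and all of them lie in
    the past. A path with as many edges as the past has elements would have one vertex too many. *)
Lemma long_finite_past (R : realType) (V : choiceType) (g : graph V)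
    (s : V -> R) v :
  finite_set (past g s v) -> exists k, ~ long (down g s) k v.
Proof.
move=> fp; exists #|` fset_set (past g s v)| => lv.
have [p pp sp] := long_path lv.
have tr : transitive (fun x y => s y < s x).
  by move=> y x z xy yz; exact: lt_trans yz xy.
have ps : path (fun x y => s y < s x) v p.
  by apply: sub_path pp => x y /andP[].
have up : uniq (v :: p).
  apply: (@sorted_uniq _ _ tr _ (v :: p)) ps.
  by move=> x; apply/negbTE; rewrite -leNgt.
have sub : {subset v :: p <= fset_set (past g s v)}.
  move=> x xp; rewrite in_fset_set // inE.
  move: xp; rewrite in_cons => /predU1P[->|xp]; first exact: past_root.
  case/splitPr: xp pp => p1 p2 pp.
  exists (rcons p1 x); rewrite last_rcons; split => //.
  suff : path (down g s) v (rcons p1 x) by [].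
  by move: pp; rewrite cat_path rcons_path /= => /and3P[-> -> _].
have := uniq_leq_size up sub.
by rewrite /= sp ltnn.
Qed.

(** * Measurability *)

Section Measurability.
Context d (T : measurableType d).

(** Vertex types are countable, so events on random graphs are written as formulas with countable
    quantifiers. This lemma and the next ones follow the connectives of such formulas. *)
Lemma measurable_exists (I : countType) (F : I -> set T) :
  (forall i, measurable (F i)) -> measurable [set w | exists i, F i w].
Proof.
move=> mF; rewrite [X in measurable X](_ : _ = \bigcup_i F i).
  by apply: countable_bigcupT_measurable => //; exact: countableP.
by apply/seteqP; split => w /= => [[i Fi]|[i _ Fi]]; exists i.
Qed.

Lemma measurable_not (A : set T) : measurable A -> measurable [set w | ~ A w].
Proof. exact: measurableC. Qed.

Lemma measurable_conj (A B : set T) :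
  measurable A -> measurable B -> measurable [set w | A w /\ B w].
Proof. exact: measurableI. Qed.

Lemma measurable_Prop (Q : Prop) : measurable [set _ : T | Q].
Proof.
have [q|q] := pselect Q.
  by rewrite [X in measurable X](_ : _ = setT) //; apply/seteqP; split.
by rewrite [X in measurable X](_ : _ = set0) //; apply/seteqP; split.
Qed.

Lemma measurable_imply (A B : set T) :
  measurable A -> measurable B -> measurable [set w | A w -> B w].
Proof.
move=> mA mB; rewrite [X in measurable X](_ : _ = ~` A `|` B).
  by apply: measurableU => //; exact: measurableC.
apply/seteqP; split => w /=; last by case.
by move=> AB; have [/AB|] := pselect (A w); [right|left].
Qed.

Lemma measurable_forall (I : countType) (F : I -> set T) :
  (forall i, measurable (F i)) -> measurable [set w | forall i, F i w].
Proof.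
move=> mF.
rewrite [X in measurable X](_ : _ = [set w | ~ exists i, ~ F i w]).
  by apply: measurable_not; apply: measurable_exists => i; exact: measurable_not.
apply/seteqP; split => w /= => [Fw [i]|nF i]; first by apply.
by apply: contrapT => nFi; apply: nF; exists i.
Qed.

Lemma measurable_eqb (f : T -> bool) b :
  measurable [set w | f w] -> measurable [set w | f w = b].
Proof.
move=> mf; case: b => //.
rewrite [X in measurable X](_ : _ = ~` [set w | f w]); first exact: measurableC.
by apply/seteqP; split => w /= => [->|/negP/negbTE].
Qed.

Lemma measurable_andb (f g : T -> bool) :
  measurable [set w | f w] -> measurable [set w | g w] ->
  measurable [set w | f w && g w].
Proof.
move=> mf mg; rewrite [X in measurable X](_ : _ = [set w | f w] `&` [set w | g w]).
  exact: measurableI.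
by apply/seteqP; split => w /= => [/andP|[-> ->]].
Qed.

Variable V : countType.

Lemma measurable_at (rho : T -> V) (A : V -> set T) :
  root_events rho `<=` measurable -> (forall v, measurable (A v)) ->
  measurable [set w | A (rho w) w].
Proof.
move=> mrho mA.
rewrite [X in measurable X](_ : _ = [set w | exists v, rho w = v /\ A v w]).
  apply: measurable_exists => v; apply: measurable_conj => //.
  by apply: mrho; exists v.
by apply/seteqP; split => w /= => [|[v [->]]] //; exists (rho w).
Qed.

Section RandomRelation.
Variable D : T -> rel V.
Hypothesis mD : forall u v, measurable [set w | D w u v].

Lemma measurable_win k v : measurable [set w | win (D w) k v].
Proof.
elim: k v => [|k IH] v /=; first exact: measurable_Prop.
apply: measurable_forall => u.
by apply: measurable_imply; [exact: mD|exact: (measurable_not (IH u))].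
Qed.

Lemma measurable_long k v : measurable [set w | long (D w) k v].
Proof.
elim: k v => [|k IH] v /=; first exact: measurable_Prop.
rewrite [X in measurable X](_ : _ = [set w | exists u, D w v u /\ long (D w) k u]).
  by apply: measurable_exists => u; exact: (measurable_conj (mD v u) (IH u)).
by apply/seteqP; split => w /= [u]; [|case]; exists u.
Qed.

Lemma measurable_path v p : measurable [set w | path (D w) v p].
Proof.
elim: p v => [|u p IH] v /=; first exact: measurable_Prop.
exact: measurable_andb.
Qed.

(** The filter [Q] serves both balls, where it bounds the length of the path, and pasts, where it is
    trivial. *)
Lemma measurable_reach (Q : pred (seq V)) v u :
  measurable [set w | exists p, [/\ Q p, path (D w) v p & last v p = u]].
Proof.
apply: measurable_exists => p.
rewrite [X in measurable X](_ : _ = [set w | (Q p /\ last v p = u) /\ path (D w) v p]).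
  by apply: measurable_conj; [exact: measurable_Prop|exact: measurable_path].
by apply/seteqP; split => w /= => [[]|[[]]].
Qed.

End RandomRelation.

Section RandomGraphs.
Variable G : T -> graph V.
Hypothesis mG : graph_events G `<=` measurable.

Lemma measurable_vert v : measurable [set w | vert (G w) v].
Proof. by apply: mG; left; exists v. Qed.

Lemma measurable_adj u v : measurable [set w | adj (G w) u v].
Proof. by apply: mG; right; exists u, v. Qed.

Lemma measurable_down (R : realType) (X : V -> T -> R) u v :
  (forall v, measurable_fun setT (X v)) ->
  measurable [set w | down (G w) (X^~ w) u v].
Proof.
move=> mX; apply: measurable_andb; first exact: measurable_adj.
rewrite [X in measurable X](_ : _ = setT `&` (fun w => X v w < X u w) @^-1` [set true]).
  by apply: measurable_fun_ltr.
by rewrite setTI; apply/seteqP; split => w.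
Qed.

Lemma measurable_induced (A : T -> set V) :
  (forall v, measurable [set w | A w v]) ->
  graph_events (fun w => Defs.induced (G w) (A w)) `<=` measurable.
Proof.
move=> mA.
have mA' v : measurable [set w | v \in A w].
  rewrite [X in measurable X](_ : _ = [set w | A w v]) //.
  by apply/seteqP; split => w /=; rewrite inE.
move=> _ [[v ->]|[u [v ->]]] /=.
  by apply: measurable_andb => //; exact: measurable_vert.
apply: measurable_andb; first exact: measurable_adj.
exact: measurable_andb.
Qed.

Lemma measurable_rooted_ball (rho : T -> V) r :
  root_events rho `<=` measurable ->
  graph_events (fun w => rooted_ball (G w) (rho w) r) `<=` measurable.
Proof.
move=> mrho; apply: measurable_induced => u.
apply: (measurable_at (A := fun v w => ball_verts (G w) v r u)) => // v.
by apply: (measurable_reach _ (fun p => size p <= r)%N) => x y; exact: measurable_adj.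
Qed.

Lemma measurable_past (R : realType) (X : V -> T -> R) (rho : T -> V) u :
  (forall v, measurable_fun setT (X v)) -> root_events rho `<=` measurable ->
  measurable [set w | past (G w) (X^~ w) (rho w) u].
Proof.
move=> mX mrho.
apply: (measurable_at (A := fun v w => past (G w) (X^~ w) v u)) => // v.
rewrite [X in measurable X](_ : _ = [set w | exists p,
    [/\ true, path (down (G w) (X^~ w)) v p & last v p = u]]).
  by apply: (measurable_reach _ xpredT) => x y; exact: measurable_down.
by apply/seteqP; split => w /= [p []]; exists p.
Qed.

End RandomGraphs.

Lemma graph_ext (g h : graph V) :
  vert g =1 vert h -> adj g =2 adj h -> g = h.
Proof.
case: g => gv ga g1 g2 g3; case: h => hv ha h1 h2 h3 /= /funext vE aE.
have {}aE : ga = ha by apply/funext => x; apply/funext => y.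
by subst; congr Graph; exact: Prop_irrelevance.
Qed.

(** Although there may be uncountably many graphs on [V], equality with a fixed one is a countable
    conjunction of vertex and edge events. *)
Lemma measurable_eq_graph (G : T -> graph V) g :
  graph_events G `<=` measurable -> measurable [set w | G w = g].
Proof.
move=> mG.
rewrite [X in measurable X](_ : _ = [set w | (forall v, vert (G w) v = vert g v) /\
                                (forall u v, adj (G w) u v = adj g u v)]).
  apply: measurable_conj; apply: measurable_forall => u.
    by apply: measurable_eqb; exact: measurable_vert.
  apply: measurable_forall => v.
  by apply: measurable_eqb; exact: measurable_adj.
apply/seteqP; split => w /= => [->|[]] //.
exact: graph_ext.
Qed.

Lemma measurable_cst_graph (g : graph V) :
  graph_events (fun _ : T => g) `<=` measurable.
Proof. by move=> _ [[v ->]|[u [v ->]]]; exact: measurable_Prop. Qed.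

(** The greedy set depends on the labels only through their comparisons on the finite list [l]. The
    event splits over the countably many lists [c] of pairs that can record these comparisons, and
    for each [c] the resulting set [gm c] is deterministic. *)
Lemma measurable_greedy (R : realType) (X : V -> T -> R) (g : graph V) v :
  (forall v, measurable_fun setT (X v)) ->
  measurable [set w | v \in greedy_mis g (X^~ w)].
Proof.
move=> mX; pose l := enum_fset (fset_set (verts g)).
pose gm (c : seq (V * V)) := foldl (fun (I : {fset V}) v =>
  if has (adj g v) (enum_fset I) then I else (v |` I)%fset)
  fset0 (sort (fun x y => (x, y) \in c) l).
rewrite [X in measurable X](_ : _ = [set w | exists c : seq (V * V),
    v \in gm c /\ forall x y, x \in l -> y \in l ->
      (X x w <= X y w) = ((x, y) \in c)]); last first.
  apply/seteqP; split => w /=.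
  - move=> vg; pose c := [seq p <- [seq (x, y) | x <- l, y <- l]
                         | X p.1 w <= X p.2 w].
    have cE x y : x \in l -> y \in l -> (X x w <= X y w) = ((x, y) \in c).
      by move=> xl yl; rewrite mem_filter /= allpairs_f // andbT.
    exists c; split => //; rewrite /gm -(@eq_in_sort _ l _ _ cE).
    exact: vg.
  - by move=> [c [vc cE]]; rewrite /greedy_mis (@eq_in_sort _ l _ _ cE).
apply: measurable_exists => c; apply: measurable_conj.
  exact: measurable_Prop.
apply: measurable_forall => x; apply: measurable_forall => y.
apply: measurable_imply; first exact: measurable_Prop.
apply: measurable_imply; first exact: measurable_Prop.
apply: measurable_eqb.
rewrite [X in measurable X](_ : _ = setT `&` (fun w => X x w <= X y w) @^-1` [set true]).
  by apply: measurable_fun_ler.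
by rewrite setTI; apply/seteqP; split => w.
Qed.

End Measurability.

(** * Finite graphs coded in a countable type *)

Section Codes.
Variable V : countType.

Local Notation code := ({fset V} * {fset V * V})%type.

Definition gcode (g : graph V) : code :=
  (fset_set (verts g), fset_set [set e : V * V | adj g e.1 e.2]).

Definition code_vert (c : code) : pred V := fun v => v \in c.1.

(** Symmetry, irreflexivity and adjacency inside the vertex set are forced here, so that every code
    decodes to a graph. On the code of a finite graph nothing changes. *)
Definition code_adj (c : code) : rel V := fun u v =>
  [&& u != v, u \in c.1, v \in c.1 & ((u, v) \in c.2) || ((v, u) \in c.2)].

Fact code_sym c : symmetric (code_adj c).
Proof.
by move=> u v; rewrite /code_adj eq_sym [in RHS]orbC; congr (_ && _); rewrite andbCA.
Qed.

Fact code_irrefl c : irreflexive (code_adj c).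
Proof. by move=> u; rewrite /code_adj eqxx. Qed.

Fact code_adj_vert c u v : code_adj c u v -> code_vert c u && code_vert c v.
Proof. by move=> /and4P[_ uc vc _]; exact/andP. Qed.

Definition gdecode (c : code) : graph V :=
  Graph (@code_sym c) (@code_irrefl c) (@code_adj_vert c).

Lemma finite_gdecode c : finite_graph (gdecode c).
Proof. exact: finite_fset. Qed.

Lemma gcodeK (g : graph V) : finite_graph g -> gdecode (gcode g) = g.
Proof.
move=> fg.
have fe : finite_set [set e : V * V | adj g e.1 e.2].
  apply: (sub_finite_set _ (finite_setX fg fg)) => -[x y] /= xy.
  exact/andP/(adj_vert xy).
have vE u : (u \in verts g) = vert g u by apply/idP/idP; rewrite inE.
have eE u v : ((u, v) \in [set e : V * V | adj g e.1 e.2]) = adj g u v.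
  by apply/idP/idP; rewrite inE.
apply: graph_ext => [v|u v] /=; first by rewrite /code_vert in_fset_set // vE.
rewrite /code_adj !in_fset_set // !vE !eE [adj g v u]adj_sym orbb.
apply/idP/idP => [/and4P[]//|uv]; have /andP[gu gv] := adj_vert uv.
rewrite gu gv uv !andbT.
by apply/eqP => uv'; rewrite uv' adj_irrefl in uv.
Qed.

End Codes.

(** * Independent uniform labels *)

Section Labels.
Context d (T : measurableType d) (R : realType) (P : probability T R).
Variables (V : countType) (sigma : V -> {RV P >-> R}).

(** The part of [random_labelling] that concerns the labels alone, which is all that matters once
    the graph is deterministic. *)
Definition iid_uniform :=
  (forall v (B : set R), measurable B ->
     distribution P (sigma v) B = uniform_prob (@ltr01 R) B) /\
  mutually_independent P
    (fun v => preimage_set_system setT (sigma v) measurable).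

Hypothesis iid : iid_uniform.

Lemma iid_uniform_rect (J : {fset V}) (B : V -> set R) :
  (forall v, measurable (B v)) ->
  P [set w | forall v, v \in J -> B v (sigma v w)] =
  (\prod_(v <- enum_fset J) uniform_prob (@ltr01 R) (B v))%E.
Proof.
move=> mB; case: iid => distr indep.
rewrite (_ : mkset _ = \bigcap_(v in [set` J]) (sigma v @^-1` B v)) //.
rewrite indep.
  by apply: eq_bigr => v _; rewrite -(distr v).
by move=> v _; exists (B v) => //; rewrite setTI.
Qed.

Lemma uniform_prob_itv_le (a b : R) : a <= b ->
  (uniform_prob (@ltr01 R) `[a, b]%classic <= (b - a)%:E)%E.
Proof.
move=> ab; rewrite /uniform_prob.
apply: (@le_trans _ _ (\int[lebesgue_measure]_(x in `[a, b]) (cst 1%E x))%E).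
  apply: ge0_le_integral => //=.
  - by move=> x _; rewrite lee_fin uniform_pdf_ge0.
  - by apply/measurable_EFinP/measurable_funTS; exact: measurable_uniform_pdf.
  - move=> x _; rewrite lee_fin /uniform_pdf; case: ifP => // _.
    by rewrite subr0 invr1.
rewrite integral_cst //= mul1e lebesgue_measure_itv /= lte_fin.
by case: ltP => // ba; rewrite lee_fin subr_ge0.
Qed.

Lemma uniform_prob_setC01 :
  uniform_prob (@ltr01 R) (~` `[0, 1]%classic) = 0%E.
Proof.
rewrite probability_setC //.
rewrite [X in (1 - X)%E](_ : _ = 1%E); last exact: integral_uniform_pdf1.
by rewrite subee.
Qed.

Lemma measurable_tie u v : measurable [set w | sigma u w = sigma v w].
Proof.
rewrite [X in measurable X](_ : _ =
    setT `&` (fun w => sigma u w == sigma v w) @^-1` [set true]).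
  by apply: measurable_fun_eqr.
by rewrite setTI; apply/seteqP; split => w /= /eqP.
Qed.

(* A tie puts both labels in one of the intervals [i/(n+1), (i+1)/(n+1)]. *)
Lemma tie_le u v n : u != v ->
  (P [set w | sigma u w = sigma v w] <= (n.+1%:R^-1)%:E)%E.
Proof.
move=> uv; pose I (i : nat) : set R :=
  `[i%:R / n.+1%:R, i.+1%:R / n.+1%:R]%classic.
have mI i : measurable (I i) by exact: measurable_itv.
have n0 : (0 : R) < n.+1%:R by rewrite ltr0n.
pose A i := [set w | forall x, x \in [fset u; v]%fset -> I i (sigma x w)].
(* Labels are uniform only in law: they may leave the unit interval, on a null event. *)
pose N := sigma u @^-1` (~` `[0, 1]%classic).
have mN : measurable N.
  by rewrite -[N]setTI; apply: measurable_funP => //; exact: measurableC.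
have mA i : measurable (A i).
  rewrite [X in measurable X](_ : _ = sigma u @^-1` I i `&` sigma v @^-1` I i).
    by apply: measurableI; rewrite -[_ @^-1` _]setTI; exact: measurable_funP.
  apply/seteqP; split => w /=.
    by move=> Aw; split; apply: Aw; rewrite !inE eqxx ?orbT.
  by move=> [Iu Iv] x; rewrite !inE => /orP[/eqP ->|/eqP ->].
(* By independence each [A i] costs the square of the interval length, so the [n.+1] of them add up
   to one interval length. *)
have PA i : (P (A i) <= (n.+1%:R^-1 * n.+1%:R^-1)%:E)%E.
  rewrite /A (@iid_uniform_rect _ (fun=> I i)) // big_fsetU1 ?inE //= big_seq_fset1.
  have UI : (uniform_prob (@ltr01 R) (I i) <= (n.+1%:R^-1)%:E)%E.
    apply: le_trans (uniform_prob_itv_le _) _.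
      by rewrite ler_pM2r ?invr_gt0 // ler_nat.
    by rewrite lee_fin -mulrBl -natr1 addrAC subrr add0r mul1r.
  by rewrite EFinM; apply: lee_pmul.
apply: (@le_trans _ _ (P (N `|` \big[setU/set0]_(i < n.+1) A i))).
  apply: le_measure; rewrite ?inE.
  - exact: measurable_tie.
  - by apply: measurableU => //; exact: bigsetU_measurable.
  move=> w /= suv.
  have [/andP[s0 s1]|Nw] := boolP (0 <= sigma u w <= 1); last first.
    by left; rewrite /N /= in_itv /=; exact/negP.
  right.
  rewrite -bigcup_mkord.
  (* The label 1 would be truncated to the index [n.+1], which is out of range; it belongs to the
     last interval. *)
  have [s11|s11] := eqVneq (sigma u w) 1.
    exists n => //= x; rewrite !inE /I /= in_itv /= => xuv.
    have -> : sigma x w = 1 by case/orP: xuv => /eqP ->; rewrite -?suv.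
    by rewrite divff ?gt_eqF // lexx andbT ler_pdivrMr // mul1r ler_nat.
  have s1' : sigma u w < 1 by rewrite lt_neqAle s11.
  have su0 : 0 <= sigma u w * n.+1%:R by rewrite mulr_ge0 // ltW.
  exists (Num.truncn (sigma u w * n.+1%:R)).
    by rewrite /= truncn_lt_nat // gtr_pMl.
  move=> x; rewrite !inE /I /= in_itv /= => xuv.
  have -> : sigma x w = sigma u w by case/orP: xuv => /eqP ->.
  rewrite ler_pdivrMr // ler_pdivlMr // truncn_le su0 /=.
  exact/ltW/truncnS_gt.
apply: le_trans (measureU2 _ _ _) _ => //; first exact: bigsetU_measurable.
have PN : P N = 0%E.
  rewrite -uniform_prob_setC01; case: iid => distr _; rewrite -(distr u) //.
  exact: measurableC.
rewrite [X in (X + _)%E](_ : _ = 0%E) // add0e; apply: le_trans (Boole_inequality _ _) _ => //.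
apply: (@le_trans _ _ (\sum_(i < n.+1) (n.+1%:R^-1 * n.+1%:R^-1)%:E)%E).
  by apply: lee_sum => i _; exact: PA.
by rewrite sumEFin lee_fin sumr_const card_ord -[X in X <= _]mulr_natl mulrA divff ?mul1r.
Qed.

Lemma tie0 u v : u != v -> P [set w | sigma u w = sigma v w] = 0%E.
Proof.
move=> uv; apply/eqP; rewrite eq_le measure_ge0 andbT.
apply/lee_addgt0Pr => e e0; rewrite add0e.
have [n ne] : exists n, n.+1%:R^-1 < e.
  exists (Num.truncn e^-1); rewrite -[ltRHS]invrK ltf_pV2 ?posrE ?invr_gt0 //.
  by rewrite truncnS_gt.
by apply: le_trans (tie_le n uv) _; rewrite lee_fin ltW.
Qed.

(** Non-injectivity is a countable union of null ties, indexed by the pairs of vertices. *)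
Lemma ae_injective_labels : {ae P, forall w, injective (sigma^~ w)}.
Proof.
pose B (p : V * V) := [set w | p.1 != p.2 /\ sigma p.1 w = sigma p.2 w].
have B0 p : P.-negligible (B p).
  have [p12|p12] := eqVneq p.1 p.2.
    rewrite (_ : B p = set0); first exact: negligible_set0.
    by apply/seteqP; split => w //= -[]; rewrite p12 eqxx.
  exists [set w | sigma p.1 w = sigma p.2 w]; split.
  - exact: measurable_tie.
  - exact: tie0.
  - by move=> w [].
suff : P.-negligible (~` [set w | injective (sigma^~ w)]) by [].
pose C n := if (choice.unpickle n : option (V * V)) is Some p then B p else set0.
apply: (negligibleS (A := \bigcup_n C n)).
  move=> w /= nw; apply: contrapT => h; apply: nw => u v suv.
  apply/eqP; apply/negPn/negP => uv; apply: h.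
  by exists (choice.pickle (u, v)) => //; rewrite /C choice.pickleK.
apply: negligible_bigcup => n; rewrite /C; case: choice.unpickle => [p|]; first exact: B0.
exact: negligible_set0.
Qed.

End Labels.

(** A pi-system generating the events that depend only on the labels in [J]. As [J] is finite,
    independence gives each of these boxes a finite product as its probability. *)
Definition cylinders (R : realType) (I : countType) (J : {fset I}) :
    set (set (I -> R)) :=
  [set A | exists B : I -> set R, (forall i, measurable (B i)) /\
     A = [set x | forall i, i \in J -> B i (x i)]].

Lemma cylinders_setI (R : realType) (I : countType) (J : {fset I}) :
  setI_closed (@cylinders R I J).
Proof.
move=> _ _ [B [mB ->]] [C [mC ->]]; exists (fun i => B i `&` C i); split.
  by move=> i; exact: measurableI.
apply/seteqP; split => x /=.
  by move=> [Bx Cx] i iJ; split; [exact: Bx|exact: Cx].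
by move=> BC; split => i iJ; case: (BC i iJ).
Qed.

Lemma measurable_coord (R : realType) (I : countType) (J : {fset I}) i :
  i \in J ->
  measurable_fun setT ((fun x => x i) : g_sigma_algebraType (@cylinders R I J) -> R).
Proof.
move=> iJ _ B mB; rewrite setTI; apply: sub_sigma_algebra.
exists (fun j => if j == i then B else setT); split.
  by move=> j; case: ifP.
apply/seteqP; split => x /=.
  by move=> Bx j _; case: ifPn => // /eqP ->.
by move=> /(_ i iJ); rewrite eqxx.
Qed.

Section Transfer.
Context d (T : measurableType d) (R : realType) (P : probability T R).
Variables (V : countType) (sigma : V -> {RV P >-> R}).
Hypothesis iid : iid_uniform sigma.
Variables (I : countType) (J : {fset I}) (e : I -> V).
Hypothesis einj : {in J &, injective e}.

Let X (w : T) : g_sigma_algebraType (@cylinders R I J) :=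
  fun i => sigma (e i) w.

Lemma measurable_labels_fun : measurable_fun setT X.
Proof.
pose T' : measurableType _ := g_sigma_algebraType (@cylinders R I J).
apply: (@measurability _ _ T T' setT X (@cylinders R I J) erefl).
move=> _ [_ [B [mB ->]] <-].
rewrite setTI; apply: measurable_forall => i.
apply: measurable_imply; first exact: measurable_Prop.
suff : measurable (setT `&` sigma (e i) @^-1` B i) by rewrite setTI.
exact: measurable_funP.
Qed.

Lemma cylinder_prob (B : I -> set R) : (forall i, measurable (B i)) ->
  P (X @^-1` [set x | forall i, i \in J -> B i (x i)]) =
  (\prod_(i <- enum_fset J) uniform_prob (@ltr01 R) (B i))%E.
Proof.
move=> mB.
(* The box is pushed forward along [e]. Since [e] is injective on [J], the fibre over [e i] is a
   single index; off the image of [J] the empty intersection imposes no constraint. *)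
pose C v := \bigcap_(i in [set i | i \in J /\ e i = v]) B i.
have mC v : measurable (C v).
  rewrite (_ : C v = [set x | forall i, i \in J /\ e i = v -> B i x]) //.
  apply: measurable_forall => i; apply: measurable_imply => //.
  exact: measurable_Prop.
have CE i : i \in J -> C (e i) = B i.
  move=> iJ; apply/seteqP; split => x /=; first by move=> /(_ i); apply.
  by move=> Bx j [jJ /einj ->].
rewrite (_ : _ @^-1` _ =
    [set w | forall v, v \in (e @` J)%fset -> C v (sigma v w)]); last first.
  apply/seteqP; split => w /=.
    by move=> H v /imfsetP[i /= iJ ->]; rewrite CE //; exact: H.
  by move=> H i iJ; rewrite -CE //; apply: H; apply/imfsetP; exists i.
rewrite (iid_uniform_rect iid) //.
rewrite big_imfset //=.
by apply: eq_big_seq => i iJ; rewrite CE.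
Qed.

End Transfer.

(** Dynkin's argument: both laws give every cylinder the same product of uniform probabilities, and
    the sets on which two probability laws agree are closed under complements and countable disjoint
    unions. Injectivity is asked on [J] only, as the isomorphisms used later are injective only on
    vertices. *)
Lemma iid_law (R : realType)
    d1 (T1 : measurableType d1) (P1 : probability T1 R) (V1 : countType)
    (sigma1 : V1 -> {RV P1 >-> R})
    d2 (T2 : measurableType d2) (P2 : probability T2 R) (V2 : countType)
    (sigma2 : V2 -> {RV P2 >-> R})
    (I : countType) (J : {fset I}) (e1 : I -> V1) (e2 : I -> V2)
    (A : set (I -> R)) :
  iid_uniform sigma1 -> iid_uniform sigma2 ->
  {in J &, injective e1} -> {in J &, injective e2} ->
  <<s @cylinders R I J >> A ->
  P1 [set w | A (fun i => sigma1 (e1 i) w)] =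
  P2 [set w | A (fun i => sigma2 (e2 i) w)].
Proof.
move=> iid1 iid2 inj1 inj2.
pose T' := g_sigma_algebraType (@cylinders R I J).
pose X1 w : T' := fun i => sigma1 (e1 i) w.
pose X2 w : T' := fun i => sigma2 (e2 i) w.
have mX1 B : measurable B -> measurable (X1 @^-1` B).
  move=> mB; rewrite -[X in measurable X]setTI.
  exact: (measurable_labels_fun sigma1 e1).
have mX2 B : measurable B -> measurable (X2 @^-1` B).
  move=> mB; rewrite -[X in measurable X]setTI.
  exact: (measurable_labels_fun sigma2 e2).
pose Q A := P1 (X1 @^-1` A) = P2 (X2 @^-1` A).
have QT : Q setT by rewrite /Q !preimage_setT !probability_setT.
have QG : @cylinders R I J `<=` Q.
  move=> _ [B [mB ->]].
  by rewrite /Q (cylinder_prob iid1 inj1 mB) (cylinder_prob iid2 inj2 mB).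
have QC (S : set T') : measurable S -> Q S -> Q (~` S).
  move=> mS; rewrite /Q -!preimage_setC => IH.
  by rewrite (probability_setC P1 (mX1 _ mS)) (probability_setC P2 (mX2 _ mS)) IH.
have QU (F : (set T')^nat) : (forall n, measurable (F n)) ->
    trivIset setT F -> (forall n, Q (F n)) -> Q (\bigcup_n F n).
  move=> mF tF IH; rewrite /Q !preimage_bigcup.
  have m1 i := mX1 _ (mF i); have m2 i := mX2 _ (mF i).
  have t1 : trivIset setT (fun n => X1 @^-1` F n).
    by move=> i j _ _ [w [Fi Fj]]; apply: tF => //; exists (X1 w).
  have t2 : trivIset setT (fun n => X2 @^-1` F n).
    by move=> i j _ _ [w [Fi Fj]]; apply: tF => //; exists (X2 w).
  rewrite (measure_semi_bigcup P1 m1 t1 (bigcupT_measurable _ m1)).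
  rewrite (measure_semi_bigcup P2 m2 t2 (bigcupT_measurable _ m2)).
  by apply: eq_eseriesr => i _; exact: IH.
exact: (@dynkin_induction _ T' _ Q erefl (@cylinders_setI R I J) QT QG QC QU A).
Qed.

Section Image.
Variables (V : countType) (g : graph V).

Let ivert : pred nat := fun m => `[< exists2 v, vert g v & choice.pickle v = m >].
Let iadj : rel nat := fun m n =>
  `[< exists u v, [/\ choice.pickle u = m, choice.pickle v = n & adj g u v] >].

Let pinj : injective (@choice.pickle V).
Proof. exact: pcan_inj (@choice.pickleK V). Qed.

Fact image_sym : symmetric iadj.
Proof.
by move=> m n; apply/asboolP/asboolP => -[u [v [um vn uv]]];
  exists v, u; rewrite adj_sym.
Qed.

Fact image_irrefl : irreflexive iadj.
Proof.
move=> m; apply/asboolP => -[u [v [<- /pinj -> uv]]].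
by rewrite adj_irrefl in uv.
Qed.

Fact image_vert m n : iadj m n -> ivert m && ivert n.
Proof.
move=> /asboolP[u [v [um vn uv]]]; have /andP[gu gv] := adj_vert uv.
by apply/andP; split; apply/asboolP; [exists u|exists v].
Qed.

(** Numbering the countable type by [pickle] gives a copy on natural numbers. Hence graphs with
    equal classes have a common copy, whereas two empty classes would be equal without any
    isomorphism. *)
Lemma class_of_nonempty v : class_of g v !=set0.
Proof.
exists (Graph image_sym image_irrefl image_vert, choice.pickle v).
exists choice.pickle; split => //=.
- split.
  + by move=> u gu; apply/asboolP; exists u.
  + by move=> x y _ _; exact: pinj.
  + by move=> m /asboolP[u gu <-]; exists u.
- move=> x y gx gy; apply/asboolP/idP; last by exists x, y.
  by move=> [u [u' [/pinj -> /pinj ->]]].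
Qed.

End Image.

(** * Invariance of the recursion's law under isomorphism *)

Section Law.
Variable R : realType.

Lemma cylinders_down (I : countType) (h : graph I) u v : finite_graph h ->
  <<s @cylinders R I (fset_set (verts h)) >> [set x | down h x u v].
Proof.
move=> fh; set J := fset_set _.
pose T' := g_sigma_algebraType (@cylinders R I J).
have [uv|nuv] := boolP (adj h u v); last first.
  rewrite (_ : mkset _ = set0); first exact: (@measurable0 _ T').
  by apply/seteqP; split => x //; rewrite /= /down (negbTE nuv).
have /andP[hu hv] := adj_vert uv.
rewrite (_ : mkset _ =
   setT `&` (fun x : T' => x v < x u) @^-1` [set true]); last first.
  by rewrite setTI; apply/seteqP; split => x; rewrite /= /down uv.
apply: (@measurable_fun_ltr _ T') => //; apply: measurable_coord;
  by rewrite in_fset_set // inE.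
Qed.


(** The flag treats together the approximating event ([true]) and the error event ([false]). *)
Definition winlong (b : bool) := if b then win else long.

Lemma measurable_winlong b d (T : measurableType d) (V : countType)
    (D : T -> rel V) : (forall u v, measurable [set w | D w u v]) ->
  forall k v, measurable [set w | winlong b (D w) k v].
Proof. by case: b => mD k v; [exact: measurable_win|exact: measurable_long]. Qed.

Lemma winlong_ball b (V : Type) (g : graph V) (s : V -> R) v r :
  winlong b (down (rooted_ball g v r) s) r v <-> winlong b (down g s) r v.
Proof. by case: b; [exact: win_ball|exact: long_ball]. Qed.

Lemma winlong_iso b (V W : Type) (g : graph V) (h : graph W) (f : V -> W)
    (t : W -> R) : set_bij (verts g) (verts h) f ->
  (forall x y, verts g x -> verts g y -> adj h (f x) (f y) = adj g x y) ->
  forall k x, verts g x ->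
  winlong b (down g (t \o f)) k x <-> winlong b (down h t) k (f x).
Proof.
by case: b => fbij fadj k x gx; [exact: (win_iso t fbij fadj k gx)|
                                 exact: (long_iso t fbij fadj k gx)].
Qed.

(* Both sides are the law of the labels of the vertices of [h], transported
   along the isomorphisms. *)
Lemma winlong_law b k
    d1 (T1 : measurableType d1) (P1 : probability T1 R) (V1 : countType)
    (sigma1 : V1 -> {RV P1 >-> R}) (g1 : graph V1) v1
    d2 (T2 : measurableType d2) (P2 : probability T2 R) (V2 : countType)
    (sigma2 : V2 -> {RV P2 >-> R}) (g2 : graph V2) v2 :
  iid_uniform sigma1 -> iid_uniform sigma2 ->
  finite_graph g1 -> verts g1 v1 -> verts g2 v2 ->
  class_of g1 v1 = class_of g2 v2 ->
  P1 [set w | winlong b (down g1 (sigma1^~ w)) k v1] =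
  P2 [set w | winlong b (down g2 (sigma2^~ w)) k v2].
Proof.
move=> iid1 iid2 fg1 gv1 gv2 gE.
(* Any element of the common class serves as the intermediate graph. *)
have [[h n] gh1] := class_of_nonempty g1 v1.
have hg1 : rooted_iso g1 v1 h n := gh1.
have hg2 : rooted_iso g2 v2 h n.
  by move: gh1; rewrite gE.
have fh : finite_graph h.
  case: hg1 => f [fbij _ _]; have [_ _ /= fsurj] := fbij.
  apply: (sub_finite_set fsurj).
  exact: finite_image.
have hn : verts h n by case: hg1 => f [fbij <- _]; exact: (set_bij_homo fbij).
have [e1 [e1bij <- e1adj]] := rooted_iso_sym gv1 hg1.
have [e2 [e2bij <- e2adj]] := rooted_iso_sym gv2 hg2.
set J := fset_set (verts h).
have Jinj (V : Type) (g : graph V) (e : nat -> V) :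
    set_bij (verts h) (verts g) e -> {in J &, injective e}.
  move=> ebij x y; rewrite !in_fset_set // => xh yh.
  exact: (set_bij_inj ebij).
have := @iid_law R _ T1 P1 V1 sigma1 _ T2 P2 V2 sigma2 _ J e1 e2
  [set x | winlong b (down h x) k n] iid1 iid2 (Jinj _ _ _ e1bij)
  (Jinj _ _ _ e2bij).
have mh : <<s @cylinders R _ J >> [set x | winlong b (down h x) k n].
  pose T' := g_sigma_algebraType (@cylinders R _ J).
  apply: (@measurable_winlong b _ T' _ (fun x => down h x)) => u v.
  exact: cylinders_down.
move=> /(_ mh); rewrite (_ : mkset _ =
    [set w | winlong b (down g1 (sigma1^~ w)) k (e1 n)]); last first.
  apply/seteqP; split => w /= ?; exact/(winlong_iso b (sigma1^~ w) e1bij e1adj k hn).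
move=> ->; congr (P2 _).
apply/seteqP; split => w /= ?; exact/(winlong_iso b (sigma2^~ w) e2bij e2adj k hn).
Qed.

End Law.

(** * Integrals over countable partitions *)

Section CountablePartition.
Context d (T : measurableType d) (R : realType) (P : probability T R).
Variables (K : countType) (k : T -> K).
Hypothesis mk : forall i, measurable [set w | k w = i].

(** The pieces are indexed by natural numbers, as countable additivity of the integral requires;
    numbers that code no attained value give empty pieces. *)
Let F n := [set w | choice.pickle (k w) = n].

Let FE n : F n = set0 \/ exists i, F n = [set w | k w = i].
Proof.
have [[w Fw]|F0] := pselect (exists w, F n w); last first.
  by left; apply/seteqP; split => // w Fw; apply: F0; exists w.
right; exists (k w); rewrite -Fw; apply/seteqP; split => x;
  rewrite /F /=; last by move=> ->.
exact: (pcan_inj (@choice.pickleK K)).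
Qed.

Let mF n : measurable (F n).
Proof. by case: (FE n) => [->//|[i ->]]. Qed.

Let UF : \bigcup_n F n = setT.
Proof. by apply/seteqP; split => // w _; exists (choice.pickle (k w)). Qed.

Let tF : trivIset setT F.
Proof. by move=> i j _ _ [w [<- <-]]. Qed.

Lemma measurable_fun_pieces d' (Y : measurableType d') (f : T -> Y) :
  (forall i, measurable_fun [set w | k w = i] f) -> measurable_fun setT f.
Proof.
move=> mf; rewrite -UF; apply/measurable_fun_bigcup => // n.
case: (FE n) => [->|[i ->]]; [exact: measurable_fun_set0|exact: mf].
Qed.

Lemma measurable_fun_countable d' (Y : measurableType d') (f : K -> Y) :
  measurable_fun setT (fun w => f (k w)).
Proof.
apply: measurable_fun_pieces => i.
apply: (@eq_measurable_fun _ _ _ _ _ (cst (f i))); last exact: measurable_cst.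
by move=> w; rewrite inE /= => ->.
Qed.

Lemma eq_integral_pieces (f1 f2 : T -> \bar R) :
  measurable_fun setT f1 -> measurable_fun setT f2 ->
  (forall w, 0 <= f1 w)%E -> (forall w, 0 <= f2 w)%E ->
  (forall i, \int[P]_(w in [set w | k w = i]) f1 w =
             \int[P]_(w in [set w | k w = i]) f2 w)%E ->
  (\int[P]_w f1 w = \int[P]_w f2 w)%E.
Proof.
move=> mf1 mf2 f10 f20 f12.
rewrite -UF ge0_integral_bigcup //; last by rewrite UF.
rewrite ge0_integral_bigcup //; last by rewrite UF.
apply: eq_eseriesr => n _.
by case: (FE n) => [->|[i ->//]]; rewrite !integral_set0.
Qed.

(** Conditioning on a countable-valued variable: on the piece where [k] equals [i], independence
    makes both integrals the product of [P (A i)] and the probability of the piece. *)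
Lemma freeze (A : K -> set T) :
  (forall i, measurable (A i)) ->
  (forall i, P ([set w | k w = i] `&` A i) = P [set w | k w = i] * P (A i))%E ->
  P [set w | A (k w) w] = (\int[P]_w P (A (k w)))%E.
Proof.
move=> mA indep.
have mAk : measurable [set w | A (k w) w].
  rewrite [X in measurable X](_ : _ = [set w | exists i, k w = i /\ A i w]).
    by apply: measurable_exists => i; exact: (measurable_conj (mk i) (mA i)).
  by apply/seteqP; split => w /= => [Aw|[i [-> //]]]; exists (k w).
transitivity (\int[P]_w (\1_[set w | A (k w) w] w)%:E)%E.
  by rewrite integral_indic // setIT.
apply: eq_integral_pieces => //.
- by apply/measurable_EFinP; exact: measurable_indic.
- exact: (measurable_fun_countable (fun i => P (A i))).
- move=> i; rewrite integral_indic //.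
  transitivity (P (A i `&` [set w | k w = i])).
    by congr (P _); apply/seteqP; split => w /= [+ kw]; rewrite kw.
  rewrite setIC indep muleC -integral_cst //.
  by apply: eq_integral => w; rewrite inE /= => ->.
Qed.

End CountablePartition.

Lemma measurable_gcode d (T : measurableType d) (V : countType)
    (G : T -> graph V) c :
  graph_events G `<=` measurable -> (forall w, finite_graph (G w)) ->
  measurable [set w | gcode (G w) = c].
Proof.
move=> mG fG.
(* A code that differs from the code of its own decoding is attained by no finite graph, and its
   event is empty. *)
rewrite [X in measurable X](_ : _ =
    [set w | gcode (gdecode c) = c /\ G w = gdecode c]).
  by apply: measurable_conj; [exact: measurable_Prop|exact: measurable_eq_graph].
apply/seteqP; split => w /= => [<-|[cK ->]] //.
by rewrite gcodeK.
Qed.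

Lemma measurable_gcode_root d (T : measurableType d) (V : countType)
    (G : T -> graph V) (rho : T -> V) c :
  graph_events G `<=` measurable -> root_events rho `<=` measurable ->
  (forall w, finite_graph (G w)) ->
  measurable [set w | (gcode (G w), rho w) = c].
Proof.
move=> mG mrho fG; case: c => c v.
rewrite [X in measurable X](_ : _ =
    [set w | gcode (G w) = c /\ rho w = v]).
  by apply: measurable_conj; [exact: measurable_gcode|apply: mrho; exists v].
by apply/seteqP; split => w /= [-> ->].
Qed.

(** Outside [L] and a null set [N] the events [A] and [W] coincide, so each is contained in the
    union of the other with [L] and [N]. *)
Lemma sandwich d (T : measurableType d) (R : realType) (P : probability T R)
    (A W L : set T) :
  measurable A -> measurable W -> measurable L ->
  {ae P, forall w, ~ L w -> A w <-> W w} ->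
  (P A <= P W + P L)%E /\ (P W <= P A + P L)%E.
Proof.
move=> mA mW mL [N [mN N0 AWN]].
have le B C : measurable B -> measurable C -> B `<=` C `|` L `|` N ->
    (P B <= P C + P L)%E.
  move=> mB mC BCL; apply: (@le_trans _ _ (P (C `|` L `|` N))).
    by apply: le_measure; rewrite ?inE //; do ?apply: measurableU.
  apply: le_trans (measureU2 _ _ _) _ => //; first exact: measurableU.
  rewrite [X in (_ + X)%E](_ : _ = 0%E) // adde0.
  exact: measureU2.
have AW w : ~ N w -> ~ L w -> A w <-> W w.
  by move=> Nw; apply: contrapT => h; apply: Nw; exact: AWN.
split; apply: le => // w; have [Nw|Nw] := pselect (N w); try by right.
  have [Lw|Lw] := pselect (L w); first by left; right.
  by move=> /(AW w Nw Lw); left; left.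
have [Lw|Lw] := pselect (L w); first by left; right.
by move=> /(AW w Nw Lw); left; left.
Qed.

(** * Probabilities as functions of the rooted class *)

Section ClassProb.
Variable R : realType.

Lemma measurable_down_labels d (T : measurableType d) (V : countType)
    (X : V -> T -> R) (g : graph V) u v :
  (forall v, measurable_fun setT (X v)) ->
  measurable [set w | down g (X^~ w) u v].
Proof. by apply: measurable_down; exact: measurable_cst_graph. Qed.

Lemma measurable_winlong_labels b k d (T : measurableType d)
    (P : probability T R) (V : countType) (sigma : V -> {RV P >-> R})
    (g : graph V) v :
  measurable [set w | winlong b (down g (sigma^~ w)) k v].
Proof.
apply: (@measurable_winlong b _ T _ (fun w => down g (sigma^~ w))) => x y.
by apply: (measurable_down_labels (X := sigma)) => z; exact: measurable_funPT.
Qed.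

(* By [winlong_law] there is at most one such [x]; classes of graphs that are
   infinite or lack the root get the junk value [0]. *)
Definition class_prob (b : bool) (k : nat) (c : rooted_class) : R :=
  xget 0 [set x | exists d (T : measurableType d) (P : probability T R)
    (V : countType) (sigma : V -> {RV P >-> R}) (g : graph V) (v : V),
    [/\ iid_uniform sigma, finite_graph g, verts g v, class_of g v = c &
        x%:E = P [set w | winlong b (down g (sigma^~ w)) k v]]].

Lemma class_probE b k d (T : measurableType d) (P : probability T R)
    (V : countType) (sigma : V -> {RV P >-> R}) (g : graph V) v :
  iid_uniform sigma -> finite_graph g -> verts g v ->
  (class_prob b k (class_of g v))%:E =
  P [set w | winlong b (down g (sigma^~ w)) k v].
Proof.
move=> iid fg gv; pose p := P [set w | winlong b (down g (sigma^~ w)) k v].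
have pE : (fine p)%:E = p.
  by rewrite fineK // fin_num_measure //; exact: measurable_winlong_labels.
rewrite /class_prob (@xget_unique _ _ _ (fine p)) //.
  by exists d, T, P, V, sigma, g, v.
move=> y [d' [T' [P' [V' [sigma' [g' [v' [iid' fg' gv' gE yE]]]]]]]].
apply: EFin_inj; rewrite pE yE.
exact: winlong_law.
Qed.

Lemma class_prob_ge0 b k c : 0 <= class_prob b k c.
Proof.
rewrite /class_prob; case: xgetP => // x _.
move=> [d' [T' [P' [V' [sigma' [g' [v' [iid' fg' gv' gE yE]]]]]]]].
by rewrite -lee_fin yE.
Qed.

Lemma class_prob_le1 b k c : class_prob b k c <= 1.
Proof.
rewrite /class_prob; case: xgetP => // x _.
move=> [d' [T' [P' [V' [sigma' [g' [v' [iid' fg' gv' gE yE]]]]]]]].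
rewrite -lee_fin yE; apply: probability_le1.
exact: measurable_winlong_labels.
Qed.

End ClassProb.

(** * Finite random graphs *)

Section LabelEvents.
Context d (T : measurableType d) (R : realType) (P : probability T R).
Variables (V : countType) (sigma : V -> {RV P >-> R}).

(** Independence of labels and graph applies to events of the sigma-algebra generated here, so
    [greedy_label_event] and [winlong_label_event] establish measurability for it rather than for
    the ambient one. *)
Definition label_events : set (set T) :=
  \bigcup_v preimage_set_system setT (sigma v) measurable.

Let T' := g_sigma_algebraType label_events.

Lemma measurable_label v : measurable_fun setT (sigma v : T' -> R).
Proof.
by move=> _ B mB; apply: sub_sigma_algebra; exists v => //; exists B.
Qed.

Lemma greedy_label_event (g : graph V) v :
  <<s label_events >> [set w | v \in greedy_mis g (sigma^~ w)].
Proof.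
exact: (@measurable_greedy _ T' V R (fun v => sigma v) g v measurable_label).
Qed.

Lemma winlong_label_event b k (g : graph V) v :
  <<s label_events >> [set w | winlong b (down g (sigma^~ w)) k v].
Proof.
apply: (@measurable_winlong b _ T' _ (fun w => down g (sigma^~ w))) => x y.
exact: (@measurable_down_labels R _ T' _ (fun v => sigma v) g x y measurable_label).
Qed.

Lemma measurable_greedy_labels (g : graph V) v :
  measurable [set w | v \in greedy_mis g (sigma^~ w)].
Proof.
by apply: (measurable_greedy (X := fun v => sigma v)) => z; exact: measurable_funPT.
Qed.

End LabelEvents.

Lemma iota_graphE (R : realType) (V : choiceType) (g : graph V) (s : V -> R) :
  finite_graph g ->
  iota_graph g s = \sum_(v <- enum_fset (fset_set (verts g)))
    #|` fset_set (verts g)|%:R^-1 * (v \in greedy_mis g s)%:R.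
Proof.
move=> fg; rewrite /iota_graph mulrC -mulr_sumr; congr (_ * _).
rewrite -natr_sum; congr (_%:R).
set l := enum_fset (fset_set (verts g)); rewrite -sum1_size.
transitivity (\sum_(i <- [seq v <- l | v \in greedy_mis g s]) 1)%N.
  apply: perm_big; apply: uniq_perm; first exact: fset_uniq.
    by rewrite filter_uniq // fset_uniq.
  move=> v; rewrite mem_filter; apply/idP/andP => [vg|[]//]; split => //.
  by rewrite in_fset_set // inE; exact: greedy_mis_vert vg.
by rewrite big_filter big_mkcond; apply: eq_bigr => v _; case: (v \in _).
Qed.

Section FiniteSide.
Context d (T : measurableType d) (R : realType) (P : probability T R).
Variables (V : countType) (G : random_graph T V) (rho : random_root G).
Variable sigma : V -> {RV P >-> R}.
Hypothesis fG : forall w, finite_graph (G w).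
Hypothesis unif : uniform_root P rho.
Hypothesis lab : random_labelling sigma <<s graph_events G >>.

Let mG : graph_events G `<=` measurable := @measurable_rgraph _ _ _ G.
Let mrho : root_events rho `<=` measurable := @measurable_rroot _ _ _ _ rho.

Lemma labelling_iid F : random_labelling sigma F -> iid_uniform sigma.
Proof. by case. Qed.

Definition greedy_prob (g : graph V) v : \bar R :=
  P [set w | v \in greedy_mis g (sigma^~ w)].

Let code := (({fset V} * {fset V * V}) * V)%type.

(** A finite graph with a root takes countably many values, so any function of the pair is
    measurable. *)
Lemma measurable_fun_graph_root (f : graph V -> V -> \bar R) :
  measurable_fun setT (fun w => f (G w) (rho w)).
Proof.
rewrite (_ : (fun w => _) =
    fun w => (fun c : code => f (gdecode c.1) c.2) (gcode (G w), rho w)).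
  have mk (c : code) : measurable [set w | (gcode (G w), rho w) = c].
    exact: measurable_gcode_root.
  exact: (measurable_fun_countable mk (fun c => f (gdecode c.1) c.2)).
by apply/funext => w /=; rewrite gcodeK.
Qed.

(** On the piece where [G] is a given graph [g], both sides average [greedy_prob g v] over the
    vertices: the left side by independence of labels and graph, the right side by uniformity of the
    root. The labels are integrated out in [greedy_prob] before the root is drawn, since root and
    labels are not assumed independent. *)
Lemma iota_bar_greedy_prob :
  (iota_bar G sigma = \int[P]_w greedy_prob (G w) (rho w))%E.
Proof.
have mk c : measurable [set w | gcode (G w) = c] by exact: measurable_gcode.
have kE c w0 : gcode (G w0) = c ->
    [set w | gcode (G w) = c] = [set w | G w = gdecode c].
  move=> kw0; apply/seteqP; split => w /= kw; first by rewrite -kw gcodeK.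
  by rewrite kw -kw0 gcodeK.
have iotaE c w : gcode (G w) = c ->
    ((iota_graph (G w) (sigma^~ w))%:E =
    \sum_(v <- enum_fset (fset_set (verts (gdecode c))))
      ((#|` fset_set (verts (gdecode c))|%:R^-1)%:E *
       (\1_[set w | v \in greedy_mis (gdecode c) (sigma^~ w)] w)%:E))%E.
  move=> kw; have -> : G w = gdecode c by rewrite -kw gcodeK.
  rewrite iota_graphE; last exact: finite_gdecode.
  rewrite -sumEFin; apply: eq_bigr => v _; rewrite EFinM; congr (_ * _)%E.
  by rewrite indicE; congr ((nat_of_bool _)%:R%:E); apply/idP/idP; rewrite inE.
have mterm (g : graph V) v :
    measurable_fun setT (fun w =>
      (\1_[set w | v \in greedy_mis g (sigma^~ w)] w)%:E : \bar R).
  apply/measurable_EFinP; apply: measurable_indic.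
  exact: measurable_greedy_labels.
rewrite /iota_bar unlock; apply: (eq_integral_pieces mk).
- apply: (measurable_fun_pieces mk) => c.
  apply: (eq_measurable_fun (fun w =>
      \sum_(v <- enum_fset (fset_set (verts (gdecode c))))
      ((#|` fset_set (verts (gdecode c))|%:R^-1)%:E *
       (\1_[set w | v \in greedy_mis (gdecode c) (sigma^~ w)] w)%:E))%E).
    by move=> w; rewrite inE /= => kw; rewrite (iotaE c).
  apply: measurable_funTS; apply: emeasurable_sum => v.
  by apply: measurable_funeM; exact: mterm.
- exact: measurable_fun_graph_root.
- by move=> w; rewrite lee_fin divr_ge0.
- by move=> w; exact: measure_ge0.
move=> c.
(* An attained code is the code of [gdecode c], so by [kE] the piece is an event that [uniform_root]
   describes. *)
have [[w0 kw0]|nE] := pselect (exists w, gcode (G w) = c); last first.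
  rewrite (_ : mkset _ = set0) ?integral_set0 //.
  by apply/seteqP; split => // w kw; apply: nE; exists w.
have mE := mk c.
set g := gdecode c; set vs := enum_fset (fset_set (verts g)).
set q : R := #|` fset_set (verts g)|%:R^-1.
transitivity (\sum_(v <- vs)
  (q%:E * (greedy_prob g v * P [set w | gcode (G w) = c])))%E.
  rewrite (eq_integral (fun w => \sum_(v <- vs)
      (q%:E * (\1_[set w | v \in greedy_mis g (sigma^~ w)] w)%:E))%E); last first.
    by move=> w; rewrite inE /= => kw; rewrite (iotaE c).
  rewrite ge0_integral_sum //; last 2 first.
  - by move=> v; apply: measurable_funTS; apply: measurable_funeM; exact: mterm.
  - by move=> v w _; rewrite -EFinM lee_fin mulr_ge0 // invr_ge0.
  apply: eq_bigr => v _.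
  rewrite ge0_integralZl //; last 2 first.
  - by apply: measurable_funTS; exact: mterm.
  - by rewrite lee_fin invr_ge0.
  rewrite integral_indic //; last exact: measurable_greedy_labels.
  congr (_ * _)%E.
  (* Independence requires the piece to be an event of the sigma-algebra generated by [G]. *)
  case: lab => _ _ ind; apply: ind; first exact: greedy_label_event.
  pose T' := g_sigma_algebraType (graph_events G).
  apply: (@measurable_gcode _ T' V G c) => //.
  exact: sub_sigma_algebra.
transitivity (\sum_(v <- vs) (greedy_prob g v *
  P ([set w | rho w = v] `&` [set w | gcode (G w) = c])))%E.
  rewrite big_seq [RHS]big_seq; apply: eq_bigr => v vvs.
  rewrite muleCA; congr (_ * _)%E.
  rewrite (kE _ _ kw0) setIC.
  have gv : verts g v by move: vvs; rewrite in_fset_set ?inE //; exact: finite_gdecode.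
  exact: esym (unif (finite_gdecode c) gv).
have mr v : measurable [set w | rho w = v] by apply: mrho; exists v.
(* On this piece the root is one of the [vs], and only the term of the root survives in the sum. *)
rewrite [RHS](eq_integral (fun w => \sum_(v <- vs)
      (greedy_prob g v * (\1_[set w | rho w = v] w)%:E))%E); last first.
  move=> w; rewrite inE /= => kw.
  have Gw : G w = g by rewrite /g -kw gcodeK.
  have rvs : rho w \in vs.
    rewrite in_fset_set ?inE; last exact: finite_gdecode.
    by rewrite -Gw; exact: rroot_vert.
  rewrite (bigD1_seq (rho w)) //= ?fset_uniq //.
  rewrite indicE mem_set // mule1 Gw big1 ?adde0 // => v vr.
  rewrite indicE memNset ?mule0 //= => rv.
  by rewrite rv eqxx in vr.
rewrite ge0_integral_sum //; last 2 first.
- move=> v; apply: measurable_funTS; apply: measurable_funeM.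
  by apply/measurable_EFinP; exact: measurable_indic.
- by move=> v w _; rewrite mule_ge0 // lee_fin.
apply: eq_bigr => v _.
rewrite ge0_integralZl //; last first.
  by apply: measurable_funTS; apply/measurable_EFinP; exact: measurable_indic.
by rewrite integral_indic.
Qed.

End FiniteSide.

(** * The limit *)

Lemma finite_ball_verts (V : choiceType) (g : graph V) v r :
  locally_finite g -> finite_set (ball_verts g v r).
Proof.
move=> lfg; elim: r => [|r IH].
  apply: (sub_finite_set _ (finite_set1 v)) => u [p [+ _ <-]].
  by case: p.
pose N u := [set x | adj g u x].
have fN u : finite_set (N u).
  (* Local finiteness speaks of vertices only; other points have no neighbours. *)
  have [gu|ngu] := pselect (verts g u); first exact: lfg.
  rewrite (_ : N u = set0) //; apply/seteqP; split => // x ux.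
  by apply: ngu; have /andP[] := adj_vert ux.
apply: (@sub_finite_set _ _ (ball_verts g v r `|`
    \bigcup_(u in ball_verts g v r) N u)).
  move=> x [p [sp pp <-]]; case/lastP: p sp pp => [|p u].
    by move=> _ _; left; exact: ball_verts_root.
  rewrite size_rcons rcons_path last_rcons => sp /andP[pp pu].
  by right; exists (last v p) => //; exists p.
by rewrite finite_setU; split => //; exact: bigcup_finite.
Qed.

Lemma finite_rooted_ball (V : choiceType) (g : graph V) v r :
  locally_finite g -> finite_graph (rooted_ball g v r).
Proof.
move=> lfg; apply: (sub_finite_set _ (finite_ball_verts v r lfg)) => u /=.
by rewrite /verts /= => /andP[_]; rewrite inE.
Qed.

Lemma finite_locally_finite (V : Type) (g : graph V) :
  finite_graph g -> locally_finite g.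
Proof.
move=> fg v _; apply: (sub_finite_set _ fg) => u uv.
by have /andP[] := adj_vert uv.
Qed.

Lemma rooted_ball_root (V : Type) (g : graph V) v r :
  verts g v -> verts (rooted_ball g v r) v.
Proof.
move=> gv; apply/andP; split => //; rewrite inE.
exact: ball_verts_root.
Qed.

Section BallProb.
Context d (T : measurableType d) (R : realType) (P : probability T R).
Variables (V : countType) (sigma : V -> {RV P >-> R}).
Hypothesis iid : iid_uniform sigma.

Definition ball_class (g : graph V) v r : rooted_class :=
  class_of (rooted_ball g v r) v.

Lemma winlong_ball_prob b (g : graph V) v r :
  locally_finite g -> verts g v ->
  P [set w | winlong b (down g (sigma^~ w)) r v] =
  (class_prob R b r (ball_class g v r))%:E.
Proof.
move=> lfg gv; rewrite /ball_class (class_probE b r iid).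
- congr (P _); apply/seteqP; split => w /= ?; exact/winlong_ball.
- exact: finite_rooted_ball.
- exact: rooted_ball_root.
Qed.

(** Labels are almost surely distinct, so off the event of a decreasing path of [r] edges the
    recursion decides membership, and both events are read in the [r]-ball. *)
Lemma greedy_prob_sandwich (g : graph V) v r : finite_graph g -> verts g v ->
  (greedy_prob sigma g v <= (class_prob R true r (ball_class g v r))%:E +
                            (class_prob R false r (ball_class g v r))%:E)%E /\
  ((class_prob R true r (ball_class g v r))%:E <= greedy_prob sigma g v +
                            (class_prob R false r (ball_class g v r))%:E)%E.
Proof.
move=> fg gv; have lfg := finite_locally_finite fg.
rewrite -!winlong_ball_prob //; apply: sandwich.
- exact: measurable_greedy_labels.
- exact: measurable_winlong_labels.
- exact: measurable_winlong_labels.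
apply: filterS (ae_injective_labels iid) => w sinj nl.
apply: greedy_mis_win => // x y _ _; exact: sinj.
Qed.

End BallProb.

Lemma integral_sandwich d (T : measurableType d) (R : realType)
    (P : probability T R) (f g h : T -> \bar R) :
  measurable_fun setT f -> measurable_fun setT g -> measurable_fun setT h ->
  (forall w, 0 <= f w)%E -> (forall w, 0 <= g w)%E -> (forall w, 0 <= h w)%E ->
  (forall w, f w <= g w + h w)%E ->
  (\int[P]_w f w <= \int[P]_w g w + \int[P]_w h w)%E.
Proof.
move=> mf mg mh f0 g0 h0 fgh; rewrite -ge0_integralD //.
by apply: ge0_le_integral => //; exact: emeasurable_funD.
Qed.

Lemma iota_bar_sandwich d (T : measurableType d) (R : realType)
    (P : probability T R) (V : countType) (G : random_graph T V)
    (rho : random_root G) (sigma : V -> {RV P >-> R}) r :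
  (forall w, finite_graph (G w)) -> uniform_root P rho ->
  random_labelling sigma <<s graph_events G >> ->
  let E b := 'E_P[class_prob R b r \o
    (fun w => class_of (rooted_ball (G w) (rho w) r) (rho w))]%E in
  (iota_bar G sigma <= E true + E false)%E /\
  (E true <= iota_bar G sigma + E false)%E.
Proof.
move=> fG unif lab; rewrite (iota_bar_greedy_prob fG unif lab) /= unlock.
have iid := labelling_iid lab.
have mb b : measurable_fun setT
    (fun w => (class_prob R b r (ball_class (G w) (rho w) r))%:E).
  exact: (measurable_fun_graph_root rho fG
            (fun g v => (class_prob R b r (ball_class g v r))%:E)).
have b0 b w : (0 <= (class_prob R b r (ball_class (G w) (rho w) r))%:E)%E.
  by rewrite lee_fin class_prob_ge0.
have sw w := greedy_prob_sandwich iid r (fG w) (rroot_vert rho w).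
have mgp := measurable_fun_graph_root rho fG (greedy_prob sigma).
split; apply: integral_sandwich; try exact: mb; try exact: mgp;
  (move=> w; first [exact: b0|exact: measure_ge0|by case: (sw w)]).
Qed.

Section InfiniteSide.
Context d (T : measurableType d) (R : realType) (P : probability T R).
Variables (V : countType) (U : random_graph T V) (rho : random_root U).
Variable sigma : V -> {RV P >-> R}.
Hypothesis lfU : forall w, locally_finite (U w).
Hypothesis lab :
  random_labelling sigma <<s graph_events U `|` root_events rho >>.
Hypothesis nonexp : nonexplosive rho sigma.

Let mU : graph_events U `<=` measurable := @measurable_rgraph _ _ _ U.
Let mrho : root_events rho `<=` measurable := @measurable_rroot _ _ _ _ rho.
Let msigma v : measurable_fun setT (sigma v) := measurable_funPT (sigma v).
Let iid := labelling_iid lab.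

Definition winlong_event b r :=
  [set w | winlong b (down (U w) (sigma^~ w)) r (rho w)].

Lemma measurable_winlong_event b r : measurable (winlong_event b r).
Proof.
apply: (measurable_at (A := fun v w => winlong b (down (U w) (sigma^~ w)) r v)) => // v.
apply: (@measurable_winlong b _ T _ (fun w => down (U w) (sigma^~ w))) => x y.
exact: (measurable_down mU x y msigma).
Qed.

(** The graph [U w] may be infinite and have no code, but its [r]-ball is finite. The coded ball
    with its root is a countable-valued variable measurable for the graph and the root, hence
    independent of the labels, and [freeze] applies. *)
Lemma winlong_event_expect b r :
  P (winlong_event b r) = 'E_P[class_prob R b r \o
    (fun w => class_of (rooted_ball (U w) (rho w) r) (rho w))]%E.
Proof.
pose B w := rooted_ball (U w) (rho w) r.
have fB w : finite_graph (B w) by exact: finite_rooted_ball.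
pose A (c : ({fset V} * {fset V * V}) * V) :=
  [set w | winlong b (down (gdecode c.1) (sigma^~ w)) r c.2].
pose k w := (gcode (B w), rho w).
have Fk c : <<s graph_events U `|` root_events rho >> [set w | k w = c].
  pose T' := g_sigma_algebraType (graph_events U `|` root_events rho).
  have mU' : graph_events U `<=` (measurable : set (set T')).
    by move=> S US; apply: sub_sigma_algebra; left.
  have mrho' : root_events rho `<=` (measurable : set (set T')).
    by move=> S US; apply: sub_sigma_algebra; right.
  apply: (@measurable_gcode_root _ T' V B rho c) => //.
  exact: (@measurable_rooted_ball _ T').
have sF : <<s graph_events U `|` root_events rho >> `<=` measurable.
  apply: smallest_sub; first exact: sigma_algebra_measurable.
  by move=> S [/mU|/mrho].
have kE w : winlong_event b r w <-> A (k w) w.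
  by rewrite /A /= gcodeK //; apply: iff_sym; exact: winlong_ball.
transitivity (P [set w | A (k w) w]).
  by congr (P _); apply/seteqP; split => w /kE.
rewrite (@freeze _ _ _ P _ k).
- rewrite unlock; apply: eq_integral => w _.
  rewrite /A /= gcodeK // (class_probE b r iid) //; first exact: fB.
  by apply: rooted_ball_root; exact: rroot_vert.
- by move=> c; exact: sF (Fk c).
- by move=> c; exact: measurable_winlong_labels.
- move=> c; rewrite setIC muleC; case: lab => _ _ ind; apply: ind => //.
  exact: winlong_label_event.
Qed.

(** On an infinite graph the list of vertices defaults to the empty one, and so does the greedy
    set. *)
Lemma greedy_mis_finite (g : graph V) (s : V -> R) v :
  v \in greedy_mis g s -> finite_graph g.
Proof.
by rewrite /greedy_mis /fset_set; case: pselect.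
Qed.

Let H w := Defs.induced (U w) (past (U w) (sigma^~ w) (rho w)).

(** Membership forces the past graph to be finite, so the event is a countable union over its
    possible codes. *)
Lemma measurable_iota_rooted :
  measurable [set w | rho w \in greedy_mis (H w) (sigma^~ w)].
Proof.
apply: (measurable_at (A := fun v w => v \in greedy_mis (H w) (sigma^~ w))) => // v.
rewrite [X in measurable X](_ : _ = [set w | exists c,
    H w = gdecode c /\ v \in greedy_mis (gdecode c) (sigma^~ w)]).
  apply: measurable_exists => c; apply: measurable_conj.
    apply: measurable_eq_graph; apply: measurable_induced => // u.
    exact: (measurable_past mU u msigma mrho).
  exact: measurable_greedy_labels.
apply/seteqP; split => w /=; last by move=> [c [-> //]].
move=> vH; have fH := greedy_mis_finite vH.
by exists (gcode (H w)); rewrite gcodeK.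
Qed.

(** Almost surely the past is finite and the labels are distinct. The greedy set of the past then
    follows the recursion on the past, which agrees with the one on the whole graph because the past
    is closed under decreasing steps. *)
Lemma iota_rooted_sandwich r :
  (iota_rooted rho sigma <=
     P (winlong_event true r) + P (winlong_event false r))%E /\
  (P (winlong_event true r) <=
     iota_rooted rho sigma + P (winlong_event false r))%E.
Proof.
apply: sandwich.
- exact: measurable_iota_rooted.
- exact: measurable_winlong_event.
- exact: measurable_winlong_event.
apply: filterS2 nonexp (ae_injective_labels iid) => w fp sinj nl.
have fH : finite_graph (H w).
  apply: (sub_finite_set _ fp) => u; rewrite /verts /= => /andP[_].
  by rewrite inE.
have Hr : verts (H w) (rho w).
  apply/andP; split; first exact: rroot_vert.
  by rewrite inE; exact: past_root.
apply: (iff_trans (B := win (down (H w) (sigma^~ w)) r (rho w))).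
  apply: greedy_mis_win => //; first by move=> x y _ _; exact: sinj.
  by move=> /long_past.
exact: win_past.
Qed.

(** Continuity from above: the events decrease with [r], and on their intersection the past is
    infinite. *)
Lemma cvg_long_event : P (winlong_event false r) @[r --> \oo] --> 0%E.
Proof.
have mI : measurable (\bigcap_r winlong_event false r).
  by apply: bigcapT_measurable => r; exact: measurable_winlong_event.
rewrite -(_ : P (\bigcap_r winlong_event false r) = 0%E).
  apply: nonincreasing_cvg_mu => //.
  - by rewrite ltey_eq fin_num_measure //; exact: measurable_winlong_event.
  - by move=> r; exact: measurable_winlong_event.
  - move=> r r' rr'; apply/subsetPset => w; exact: long_le.
apply: measure_negligible => //.
apply: negligibleS nonexp => w /= lw fp.
by have [k] := long_finite_past fp; apply; exact: lw.
Qed.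

End InfiniteSide.

Lemma class_prob_continuous (R : realType) b r :
  continuous (class_prob R b r : discrete_topology rooted_class -> R).
Proof.
move=> c A /nbhs_singleton Ac.
have := @discrete_set1 (discrete_topology rooted_class) c.
have sub : [set c] `<=` class_prob R b r @^-1` A by move=> _ ->.
exact: (filterS sub).
Qed.

Lemma class_prob_bounded (R : realType) b r :
  bounded_fun (class_prob R b r : discrete_topology rooted_class -> R^o).
Proof.
exists 1; split; first exact: num_real.
move=> y y1 c _ /=; rewrite ger0_norm ?class_prob_ge0 //.
exact: le_trans (class_prob_le1 R b r c) (ltW y1).
Qed.

(** The distance from [A n] to [I] is at most that from [E true r n] to [L true r], plus
    [E false r n] and [L false r]. First [r] is chosen to make [L false r] small, then [n] is taken
    large for that [r]. *)
Lemma cvg_sandwich (R : realType) (A : nat -> \bar R) (I : \bar R)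
    (E : bool -> nat -> nat -> \bar R) (L : bool -> nat -> \bar R) :
  (forall b r n, 0 <= E b r n)%E -> (forall n, 0 <= A n)%E -> (0 <= I)%E ->
  (forall b r, L b r \is a fin_num)%E ->
  (forall b r, E b r n @[n --> \oo] --> L b r)%E ->
  (forall r n, A n <= E true r n + E false r n)%E ->
  (forall r n, E true r n <= A n + E false r n)%E ->
  (forall r, I <= L true r + L false r)%E ->
  (forall r, L true r <= I + L false r)%E ->
  (L false r @[r --> \oo] --> 0)%E ->
  (A n @[n --> \oo] --> I)%E.
Proof.
move=> E0 A0 I0 Lfin EL AE EA IL LI L0.
have Ifin : I \is a fin_num.
  rewrite ge0_fin_numE //; apply: le_lt_trans (IL 0%N) _.
  by rewrite ltey_eq fin_numD !Lfin.
pose l b r := fine (L b r).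
have lE b r : L b r = (l b r)%:E by rewrite /l fineK.
have Enear b r : \forall n \near \oo, E b r n \is a fin_num.
  by have /fine_cvgP[] : E b r n @[n --> \oo] --> (l b r)%:E by rewrite -lE.
have Ecvg b r e : 0 < e -> \forall n \near \oo, `|l b r - fine (E b r n)| < e.
  move=> e0; have /fine_cvgP[_] : E b r n @[n --> \oo] --> (l b r)%:E by rewrite -lE.
  by move=> /cvgrPdist_lt; apply.
have l0 e : 0 < e -> exists r, `|l false r| < e.
  move=> e0; have /fine_cvgP[_ /cvgrPdist_lt/(_ _ e0)[r _ /(_ r)]] := L0.
  by rewrite /= sub0r normrN => h; exists r; exact: h.
have Afin : \forall n \near \oo, A n \is a fin_num.
  near=> n; rewrite ge0_fin_numE //; apply: le_lt_trans (AE 0%N n) _.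
  rewrite ltey_eq fin_numD; apply/orP; left; apply/andP; split; near: n; exact: Enear.
rewrite -(fineK Ifin); apply/fine_cvgP; split => //.
apply/cvgrPdist_lt => e e0.
(* Four errors: one for each of the two convergences in [n], and [L false r] twice, once directly
   and once as the limit of [E false r n]. *)
have e4 : 0 < e / 4 by rewrite divr_gt0.
have [r lr] := l0 _ e4.
near=> n.
have fA : A n \is a fin_num by near: n.
have f1 : E true r n \is a fin_num by near: n; exact: Enear.
have f2 : E false r n \is a fin_num by near: n; exact: Enear.
have c1 : `|l true r - fine (E true r n)| < e / 4 by near: n; exact: Ecvg.
have c2 : `|l false r - fine (E false r n)| < e / 4 by near: n; exact: Ecvg.
have := AE r n; have := EA r n; have := IL r; have := LI r.
rewrite !lE -(fineK Ifin) -(fineK fA) -(fineK f1) -(fineK f2) -!EFinD !lee_fin /=.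
move: lr c1 c2; rewrite !ltr_norml.
lra.
Unshelve. all: by end_near.
Qed.

Theorem proposition1p1 (R : realType)
    (dn : nat -> measure_display) (Tn : forall n, measurableType (dn n))
    (Pn : forall n, probability (Tn n) R) (Vn : nat -> countType)
    (Gn : forall n, random_graph (Tn n) (Vn n))
    (rhon : forall n, random_root (Gn n))
    (sigman : forall n, Vn n -> {RV (Pn n) >-> R})
    (d : measure_display) (T : measurableType d) (P : probability T R)
    (V : countType) (U : random_graph T V) (rho : random_root U)
    (sigma : V -> {RV P >-> R})
    (Gn_finite : forall n w, finite_graph (Gn n w))
    (rhon_uniform : forall n, uniform_root (Pn n) (rhon n))
    (sigman_labelling : forall n,
       random_labelling (sigman n) <<s graph_events (Gn n) >>)
    (U_locally_finite : forall w, locally_finite (U w))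
    (U_connected : forall w, connected_graph (U w))
    (sigma_labelling :
       random_labelling sigma <<s graph_events U `|` root_events rho >>)
    (Gn_cvg : local_cvg Pn rhon P rho)
    (U_nonexplosive : nonexplosive rho sigma) :
  iota_bar (Gn n) (sigman n) @[n --> \oo] --> iota_rooted rho sigma.
Proof.
pose E b r n := ('E_(Pn n)[class_prob R b r \o
  (fun w => class_of (rooted_ball (Gn n w) (rhon n w) r) (rhon n w))])%E.
pose L b r := P (winlong_event rho sigma b r).
have sw n r := iota_bar_sandwich r (Gn_finite n) (rhon_uniform n) (sigman_labelling n).
apply: (@cvg_sandwich R _ _ E L).
- move=> b r n; rewrite /E unlock.
  by apply: integral_ge0 => w _; rewrite lee_fin class_prob_ge0.
- move=> n; rewrite /iota_bar unlock; apply: integral_ge0 => w _.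
  by rewrite lee_fin divr_ge0.
- exact: measure_ge0.
- move=> b r; rewrite fin_num_measure //; exact: measurable_winlong_event.
(* Rewriting the limit event's probability as an expectation over ball classes puts it in the form
   to which local convergence at radius [r] applies. *)
- move=> b r; rewrite /L (winlong_event_expect U_locally_finite sigma_labelling).
  apply: Gn_cvg; [exact: class_prob_continuous|exact: class_prob_bounded].
- by move=> r n; case: (sw n r).
- by move=> r n; case: (sw n r).
- by move=> r; case: (iota_rooted_sandwich sigma_labelling U_nonexplosive r).
- by move=> r; case: (iota_rooted_sandwich sigma_labelling U_nonexplosive r).
- exact: cvg_long_event.
Qed.
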